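(* Let $f\colon\mathbb N\to\mathbb U\setminus\{0\}$ be a completely multiplicative function. (i) (Logarithmic averages) The spectrum of any Furstenberg system of $f$ for logarithmic averages is a divisible subset of $\mathbb T$. (ii) (Cesàro averages) The combined spectrum of all Furstenberg systems of $f$ for Cesàro averages (i.e. the union of their spectra) is a divisible subset of $\mathbb T$. The same property holds for the spectrum of any fixed Furstenberg system of $f$ for Cesàro averages, as long as the system is ergodic.
   Context: $\mathbb N=\{1,2,\ldots\}$, $\mathbb U$ is the closed complex unit disc, $e(t)=e^{2\pi i t}$, $[N]=\{1,\ldots,N\}$, $\mathbb T=\mathbb R/\mathbb Z$ identified with $[0,1)$. A function $f\colon\mathbb N\to\mathbb U$ is completely multiplicative if $f(mn)=f(m)f(n)$ for all $m,n\in\mathbb N$. For a finite non-empty $A\subset\mathbb N$, $\mathbb E_{n\in A}a(n)=\frac1{|A|}\sum_{n\in A}a(n)$ (Cesàro average) and $\mathbb E^{\log}_{n\in A}a(n)=\big(\sum_{n\in A}\frac1n\big)^{-1}\sum_{n\in A}\frac{a(n)}n$ (logarithmic average); these also act on measures. A subset $A$ of $\mathbb T$ is called divisible if for every $\alpha\in A$ and $r\in\mathbb N$ there exists $\alpha'\in A$ such that $\alpha=r\alpha'$ (in $\mathbb T$). Let $X=\mathbb U^{\mathbb Z}$ with the product topology and let $T\colon X\to X$ be the shift $(Tx)(k)=x(k+1)$. A sequence $a\colon\mathbb N\to\mathbb U$ is extended to $\mathbb Z$ arbitrarily (the extension does not matter) and viewed as a point of $X$. If $(N_k)$ is a strictly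 increasing sequence of positive integers and the weak-star limit $\mu=\lim_{k\to\infty}\mathbb E_{n\in[N_k]}\delta_{T^na}$ exists, then $(X,\mu,T)$ is called the Furstenberg system of $a$ along $(N_k)$ for Cesàro averages. With $\mathbb E^{\log}$ in place of $\mathbb E$ one gets the Furstenberg system of $a$ along $(N_k)$ for logarithmic averages. A Furstenberg system of $a$ is one obtained along some $(N_k)$. The spectrum $\mathrm{Spec}(X,\mu,T)$ is the set of $\alpha\in[0,1)$ for which there is a non-zero $g\in L^2(\mu)$ with $g\circ T=e(\alpha)\,g$. *)

(* Defs.v *)
From HB Require Import structures.
From mathcomp Require Import all_boot all_order all_algebra.
From mathcomp Require Import all_classical all_reals all_analysis.
From mathcomp.real_closed Require Export complex.

Set Implicit Arguments.
Unset Strict Implicit.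
Unset Printing Implicit Defensive.

Import Order.TTheory GRing.Theory Num.Theory.
Import numFieldNormedType.Exports.

Local Open Scope classical_set_scope.
Local Open Scope ring_scope.
Local Open Scope complex_scope.

(* The regular module R[i]^o is R[i] with the topology of its norm. *)
Definition disc (R : realType) : set R[i]^o := [set z | `|z| <= 1].

(* U, with the topology induced by the complex plane *)
Definition unit_disc (R : realType) : Type := set_type (@disc R).

HB.instance Definition _ (R : realType) := Topological.on (unit_disc R).

Fact disc0 (R : realType) : (0 : R[i]^o) \in @disc R.
Proof. by rewrite inE /disc /= normr0 ler01. Qed.

HB.instance Definition _ (R : realType) :=
  isPointed.Build (unit_disc R) (exist _ (0 : R[i]^o) (@disc0 R)).

(* X = U^Z, with the product topology and its Borel sigma-algebra *)
Definition shift_space (R : realType) : Type :=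
  prod_topology (fun _ : int => unit_disc R).

HB.instance Definition _ (R : realType) := Topological.on (shift_space R).
HB.instance Definition _ (R : realType) :=
  isPointed.Build (shift_space R) (fun _ : int => point).
HB.instance Definition _ (R : realType) :=
  @isMeasurable.Build (sigma_display (@open (shift_space R))) (shift_space R)
    <<s @open (shift_space R) >>
    (@sigma_algebra0 _ setT (@open (shift_space R)))
    (@sigma_algebraC (shift_space R) (@open (shift_space R)))
    (@sigma_algebra_bigcup _ setT (@open (shift_space R))).

Section furstenberg.
Variable R : realType.
Local Notation X := (shift_space R).

Definition shift (x : X) : X := fun k : int => x (k + 1).

(* Sequences indexed by the positive integers are functions on nat whose
   value at 0 is irrelevant. *)
Definition completely_multiplicative (f : nat -> R[i]) : Prop :=
  forall m n : nat, (0 < m)%N -> (0 < n)%N -> f (m * n)%N = f m * f n.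

Definition extends (a : nat -> R[i]) (x : X) : Prop :=
  forall n : nat, (0 < n)%N -> val (x n%:Z) = a n.

Definition cesaro_measure (x : X) (N : nat) : {measure set X -> \bar R} :=
  mscale (N%:R^-1)%:nng (msum (fun k => \d_(iter k.+1 shift x)) N).

Fact harmonic_sum_ge0 (N : nat) : 0 <= (\sum_(k < N) k.+1%:R^-1 : R)^-1.
Proof. by rewrite invr_ge0 sumr_ge0. Qed.

Definition log_measure (x : X) (N : nat) : {measure set X -> \bar R} :=
  mscale (NngNum (harmonic_sum_ge0 N))
    (msum (fun k => mscale (k.+1%:R^-1)%:nng \d_(iter k.+1 shift x)) N).

Definition weak_star_cvg (mus : nat -> {measure set X -> \bar R})
    (mu : {measure set X -> \bar R}) : Prop :=
  forall F : X -> R, continuous F ->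
    (fun k => \int[mus k]_x F x) @ \oo --> \int[mu]_x F x.

Definition furstenberg_system (avg : X -> nat -> {measure set X -> \bar R})
    (a : nat -> R[i]) (mu : probability X R) : Prop :=
  exists (x : X) (N : nat -> nat),
    [/\ extends a x, (forall k, (0 < N k)%N), {homo N : i j / (i < j)%N}
      & weak_star_cvg (fun k => avg x (N k)) mu].

Definition log_furstenberg_system := furstenberg_system log_measure.
Definition cesaro_furstenberg_system := furstenberg_system cesaro_measure.

Definition circle_exp (t : R) : R[i] := cos (2 * pi * t) +i* sin (2 * pi * t).

(* complex-valued L^2; its elements are compared almost everywhere below *)
Definition in_L2 (mu : probability X R) (g : X -> R[i]) : Prop :=
  (fun x => complex.Re (g x)) \in Lfun mu 2%:E /\
  (fun x => complex.Im (g x)) \in Lfun mu 2%:E.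

Definition spectrum (mu : probability X R) : set R :=
  [set alpha | 0 <= alpha < 1 /\
    exists g : X -> R[i],
      [/\ in_L2 mu g, ~ {ae mu, forall x, g x = 0}
        & {ae mu, forall x, g (shift x) = circle_exp alpha * g x}]].

Definition ergodic (mu : probability X R) : Prop :=
  forall A : set X, measurable A -> shift @^-1` A = A ->
    mu A = 0%E \/ mu A = 1%E.

(* The circle is identified with [0, 1): the equality alpha = r alpha' in the
   circle is an equality of reals up to an integer. *)
Definition divisible (A : set R) : Prop :=
  A `<=` [set t | 0 <= t < 1] /\
  forall (alpha : R) (r : nat), A alpha -> (0 < r)%N ->
    exists2 alpha' : R, A alpha' & exists k : int, r%:R * alpha' = alpha + k%:~R.

End furstenberg.

(* Main.v *)
Require Import Defs.
From HB Require Import structures.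
From mathcomp Require Import all_boot all_order all_algebra.
From mathcomp Require Import all_classical all_reals all_analysis.
From mathcomp Require Import measurable_realfun lra ring zify.

Set Implicit Arguments.
Unset Strict Implicit.
Unset Printing Implicit Defensive.

Import Order.TTheory GRing.Theory Num.Theory.
Import numFieldNormedType.Exports ComplexField.Normc.

Local Open Scope classical_set_scope.
Local Open Scope ring_scope.

(** Let mu be a limit of averages of the point masses at the shifts T^m x of a
point x that extends f, let g be an eigenfunction, g o T = e(alpha) g, and let
r be a positive integer.  Complete multiplicativity says that the sequence
k |-> f(r (m + k)) is f(r) times k |-> f(m + k).  Since f(r) is not 0, the map
S that keeps the coordinates divisible by r and divides them by f(r) sends
T^(rm) x to a point that agrees with T^m x on every fixed window once m is
large.  Hence, if nu is a limit of the averages of the point masses at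
T^(rm) x, then S maps nu to mu ([dilation_limit]).  To be defined on the whole
shift space, S projects its values radially on the disc ([dilate]).

The measure nu is invariant under T^r and S o T^r = T o S, so H = g o S is an
eigenfunction of T^r for nu, with eigenvalue e(alpha).  Let mu' be the mean of
the images of nu under T^0, ..., T^(r-1).  Then nu is absolutely continuous
with respect to the T-invariant measure mu', with a T^r-invariant density phi,
and phi H is an eigenfunction of T^r for mu'.  Its twisted sums over
T^0, ..., T^(r-1) are eigenfunctions of T for mu' with eigenvalues
e((alpha + l) / r), 0 <= l < r; by Fourier inversion on Z/r they add up to
r phi H, so one of them is not 0.  Some (alpha + l) / r is therefore in the
spectrum of mu' ([spectrum_root], [spectrum_dilation]).

What remains is to identify mu', a limit of averages over the blocks
T^(rm) x, ..., T^(rm+r-1) x.  Logarithmic averages do not see the dilation of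
the interval of summation, so there mu' = mu ([log_block_mean]).  For Cesaro
averages mu' is a limit along r N_k when mu is one along N_k
([cesaro_block_mean]); this gives the union of the spectra.  For a single
ergodic mu, one starts from the averages over N_k / r instead: then mu' = mu,
while the image of nu under S is dominated by a multiple of mu
([cesaro_dilated_dominated]).  The eigenfunction g survives this change of
measure because, by ergodicity, it vanishes almost nowhere.

The limits exist by weak-star sequential compactness
([weak_star_compact]), and are recognized on continuous functions
([measure_ext]).  Compactness is obtained by lifting the averages along a
continuous surjection from the Cantor space: the clopen subsets of the Cantor
space are countably many, so a diagonal sequence of averages converges on all
of them; the limit is sigma-additive by compactness, extends to a measure by
Caratheodory's theorem, and is pushed down to the shift space. *)

(** * Topology of the disc *)

Lemma cvg_set_type (Y : topologicalType) (A : set Y) (T : Type)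
    (F : set_system T) (FF : Filter F) (g : T -> set_type A) (l : set_type A) :
  (fun t => val (g t)) @ F --> val l -> g @ F --> l.
Proof.
move=> cg B /= [C [[D oD <-] Dl DB]].
have : nbhs (val l) D by apply: open_nbhs_nbhs.
move=> /cg; rewrite /nbhs /=; apply: filterS => t; exact: DB.
Qed.

Lemma hausdorff_inj (S T : topologicalType) (f : S -> T) :
  continuous f -> injective f -> hausdorff_space T -> hausdorff_space S.
Proof.
move=> cf If hT p q pq; apply: If; apply: hT => A B /cf pA /cf qB.
by have [s [As Bs]] := pq _ _ pA qB; exists (f s).
Qed.

Section clip.
Variable R : realType.
Local Open Scope complex_scope.

Lemma normC_normc (z : R[i]) : `|z| = (normc z)%:C.
Proof. by case: z. Qed.

Lemma le_Re_normc (z : R[i]) : `|complex.Re z| <= normc z.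
Proof. by rewrite -lecR -normC_normc normc_ge_Re. Qed.

Lemma le_Im_normc (z : R[i]) : `|complex.Im z| <= normc z.
Proof.
case: z => a b; rewrite /normc /= -sqrtr_sqr ler_wsqrtr// lerDr sqr_ge0//.
Qed.

Lemma near_dist_lt (z : R[i]^o) (e : R) : 0 < e ->
  \forall w \near z, `|z - w| < e%:C.
Proof.
move=> e0; have e0' : 0 < e%:C by rewrite ltcR.
by have := @nbhsx_ballx _ _ z _ e0'; rewrite -ball_normE.
Qed.

Lemma cvg_complex (T : topologicalType) (F : set_system T) (FF : Filter F)
    (a b : T -> R) (la lb : R) : a @ F --> la -> b @ F --> lb ->
  (fun t => (a t +i* b t : R[i]^o)) @ F --> (la +i* lb : R[i]^o).
Proof.
move=> ca cb; apply/cvgrPdist_lt => e e0.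
have /complex_realP[k ek] : e \is Num.real by rewrite realE ltW.
rewrite ek ltcR in e0 *.
have k20 : 0 < k / 2 by rewrite divr_gt0.
near=> t.
have -> : (la +i* lb) - (a t +i* b t) = (la - a t)%:C + 'i * (lb - b t)%:C :> R[i].
  by simpc.
apply: le_lt_trans (ler_normD _ _) _.
rewrite normrM !normC_normc /= !expr0n /= !addr0 !sqrtr_sqr expr1n add0r sqrtr1 mul1r.
rewrite -rmorphD/= ltcR [k]splitr ltrD//.
  near: t; exact: (@cvgr_dist_lt _ _ _ _ _ _ _ ca).
near: t; exact: (@cvgr_dist_lt _ _ _ _ _ _ _ cb).
Unshelve. all: by end_near. Qed.

Definition clipc (z : R[i]) : R[i] := z / (Num.max 1 (normc z))%:C.

Lemma clip_subproof (z : R[i]) : clipc z \in @disc R.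
Proof.
have m1 : 1 <= Num.max 1 (normc z) by rewrite le_max lexx.
have m0 := lt_le_trans ltr01 m1.
have E : normc (Num.max 1 (normc z))%:C = Num.max 1 (normc z).
  by rewrite /= expr0n /= addr0 sqrtr_sqr gtr0_norm.
rewrite inE /disc /= /clipc normC_normc normcM normcV E lecR.
by rewrite ler_pdivrMr// mul1r le_max lexx orbT.
Qed.

(** Radial projection of the plane on the disc.  It makes formulas that leave
the disc, such as division by f(r), into continuous self-maps of the shift
space. *)
Definition clip (z : R[i]^o) : unit_disc R := exist _ (clipc z) (clip_subproof z).

Lemma clip_id (z : R[i]) : `|z| <= 1 -> clipc z = z.
Proof.
rewrite normC_normc lecR => z1; rewrite /clipc max_l// invr1 mulr1//.
Qed.

Lemma continuous_normc : continuous (@normc R : R[i]^o -> R).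
Proof.
move=> z; apply/(@cvgrPdist_lt _ _ _ _ (@nbhs_filter (R[i]^o) z)) => e e0.
apply: filterS (near_dist_lt z e0) => w zw.
rewrite -ltcR; apply: le_lt_trans zw.
rewrite normC_normc lecR ler_norml; apply/andP; split.
  have := le_normcD (w - z) z; rewrite subrK -(opprB z w) normcN.
  by rewrite lerNl opprB lerBlDr.
by have := le_normcD (z - w) w; rewrite subrK lerBlDr.
Qed.

Lemma continuous_clipc : continuous (clipc : R[i]^o -> R[i]^o).
Proof.
move=> z; pose m (w : R[i]) : R := Num.max 1 (normc w).
have m1 w : 1 <= m w by rewrite le_max lexx.
have FF : Filter (nbhs (z : R[i]^o)) := @nbhs_filter R[i]^o z.
have cm : m @ nbhs (z : R[i]^o) --> m z.
  apply: (@continuous_max _ R[i]^o (fun=> 1) (@normc R)).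
    exact: cvg_cst.
  exact: continuous_normc.
have cC := cvg_complex FF cm (cvg_cst (0 : R)).
apply: (@cvgM R[i] R[i] (nbhs (z : R[i]^o)) FF id (fun w => (m w +i* 0)^-1) z (m z +i* 0)^-1).
  exact: cvg_id.
apply: (@cvgV R[i] R[i] (nbhs (z : R[i]^o)) FF (fun w => (m w +i* 0)) (m z +i* 0)).
  by rewrite (inj_eq (@complexI R) _ 0) gt_eqF// (lt_le_trans ltr01).
exact: cC.
Qed.

Lemma val_continuous : continuous (val : unit_disc R -> R[i]^o).
Proof. exact: initial_continuous. Qed.

Lemma continuous_clip : continuous (clip : R[i]^o -> unit_disc R).
Proof.
move=> z; apply: (@cvg_set_type R[i]^o (@disc R) R[i]^o (nbhs (z : R[i]^o)) (@nbhs_filter R[i]^o z) clip (clip z)).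
exact: (@continuous_clipc z).
Qed.

End clip.

(** * The shift space as an image of the Cantor space *)

Lemma cvg_prod_topology (I : Type) (K : I -> topologicalType) (T : Type)
    (F : set_system T) (g : T -> prod_topology K) (l : prod_topology K) :
  Filter F -> (forall i, (fun t => g t i) @ F --> l i) -> g @ F --> l.
Proof.
move=> FF gl; apply/cvg_sup => i A /= [B [[C oC <-] Cl CA]].
have : nbhs (l i) C by apply: open_nbhs_nbhs.
move=> /gl; rewrite /nbhs /=; apply: filterS => t; exact: CA.
Qed.

Lemma continuous_proj (I : eqType) (K : I -> topologicalType) (i : I) :
  continuous (fun x : prod_topology K => x i).
Proof. exact: (@proj_continuous I K i). Qed.

HB.instance Definition _ (R : realType) : PseudoMetric R cantor_space :=
  PseudoMetric.copy cantor_space (prod_topology (fun _ : nat => bool)).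

Section cantor_cover.
Variable R : realType.
Local Notation X := (shift_space R).

Definition segment : Type := set_type [set` `[-1, 1] : interval R].
HB.instance Definition _ := PseudoMetric.on segment.

Fact segment0 : 0 \in [set` `[-1, 1] : interval R].
Proof. by rewrite inE /= in_itv /= lerN10 ler01. Qed.
HB.instance Definition _ := isPointed.Build segment (exist _ 0 segment0).

Fact clamp_subproof (t : R) :
  Num.max (-1) (Num.min 1 t) \in [set` `[-1, 1] : interval R].
Proof.
rewrite inE /= in_itv /= le_max lexx ge_max ge_min lexx /= andbT.
by rewrite (le_trans (lerN10 R)).
Qed.

Lemma compact_segment : compact [set: segment].
Proof.
pose clamp t : segment := exist (fun u => u \in [set` `[-1, 1] : interval R]) _ (clamp_subproof t).
have -> : [set: segment] = clamp @` `[-1, 1].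
  apply/seteqP; split => // t _; have := valP t; rewrite inE /= in_itv /= => /andP[t1 t2].
  exists (val t); first by rewrite /= in_itv/= t1.
  by apply/val_inj; rewrite /= min_r// max_r.
apply: continuous_compact; last exact: segment_compact.
apply: continuous_subspaceT => t.
apply: (@cvg_set_type _ _ _ (nbhs (t : R)) _ clamp (clamp t)).
apply: (@continuous_max R R (fun=> -1) (fun t => Num.min 1 t)); first exact: cvg_cst.
by apply: (@continuous_min R R (fun=> 1) id); [exact: cvg_cst|exact: cvg_id].
Qed.

Lemma segment_hausdorff : hausdorff_space segment.
Proof.
apply: (@hausdorff_inj segment R val); [exact: initial_continuous|exact: val_inj|].
exact: Rhausdorff.
Qed.

Lemma clopen_enum : exists2 e : (set cantor_space)^nat,
  forall n, clopen (e n) & forall D, clopen D -> exists n, e n = D.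
Proof.
have [e] := @clopen_surj R cantor_space cantor_space_compact.
exists e => [n|D cD]; first exact: (@funS _ _ _ _ e n I).
by have [n _ nD] := @surj _ _ _ _ e D cD; exists n.
Qed.

(** The Cantor space is zero-dimensional and has countably many clopen sets. *)
Lemma open_cantor_bigcup (O : set cantor_space) : open O ->
  exists2 K : (set cantor_space)^nat, forall n, clopen (K n) & \bigcup_n K n = O.
Proof.
move=> oO; have [e eclo esurj] := clopen_enum.
exists (fun n => e n `&` [set c | e n `<=` O]) => [n|].
  have [s|s] := pselect (e n `<=` O).
    by rewrite (_ : _ `&` _ = e n) //; apply/seteqP; split=> [c []//|c ec].
  rewrite (_ : _ `&` _ = set0); first exact: clopen0.
  by apply/seteqP; split => // c [].
apply/seteqP; split=> [c [n _ [ec s]]|c Oc]; first exact: s.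
have : nbhs c O by apply: open_nbhs_nbhs.
move/(zero_dimensional_cvg cantor_space_hausdorff cantor_zero_dimensional
  cantor_space_compact) => [D [Dc cD] DO].
by have [n nD] := esurj _ cD; exists n => //; rewrite /= nD.
Qed.

Lemma cantor_segment_surj :
  exists2 q : cantor_space -> segment, continuous q & forall t, exists c, q c = t.
Proof.
have [q cq] := cantor_surj compact_segment segment_hausdorff.
exists q => // t; have [c _ <-] := 'surj_q (I : [set: segment] t).
by exists c.
Qed.

Local Open Scope complex_scope.

(** The Cantor space covers [-1, 1], hence, the bits being split into countably
many rows, it covers a sequence of squares; clipping maps each square onto the
disc. *)
Lemma cantor_shift_space_surj :
  exists2 p : cantor_space -> X, continuous p & forall x, exists c, p c = x.
Proof.
have [q cq sq] := cantor_segment_surj.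
(* The bits of the real ([b = false]) and imaginary part of coordinate [k]. *)
pose row (c : cantor_space) (k : int) (b : bool) : cantor_space :=
  fun n => c (pickle (k, b, n)).
have crow k b : continuous (fun c => row c k b).
  move=> c; apply: cvg_prod_topology => n; exact: (@continuous_proj nat (fun=> bool) _ c).
pose p c : X := fun k => clip (val (q (row c k false)) +i* val (q (row c k true))).
exists p.
  move=> c; apply: cvg_prod_topology => k.
  apply: (@cvg_comp _ _ _ (fun c => val (q (row c k false)) +i* val (q (row c k true)) : R[i]^o) (@clip R)); last exact: continuous_clip.
  by apply: cvg_complex;
    apply: (@continuous_comp _ segment R (fun c => q (row c k _)) val);
    [apply: (continuous_comp (@crow _ _ _)); exact: cq|exact: initial_continuous
    |apply: (continuous_comp (@crow _ _ _)); exact: cq|exact: initial_continuous].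
move=> x.
have rng k (b : bool) : (if b then complex.Im (val (x k)) else complex.Re (val (x k)))
    \in [set` `[-1, 1] : interval R].
  have := valP (x k); rewrite inE /disc /= normC_normc lecR => nx.
  rewrite inE /= in_itv /= -ler_norml; case: b; apply: le_trans nx.
    exact: le_Im_normc.
  exact: le_Re_normc.
have /choice[d dE] : forall kb : int * bool, exists c, q c = exist (fun u => u \in [set` `[-1, 1] : interval R]) _ (rng kb.1 kb.2).
  by move=> kb; apply: sq.
pose c : cantor_space := fun m => if unpickle m is Some (k, b, n) then d (k, b) n else false.
have rc k b : row c k b = d (k, b) by apply/funext => n; rewrite /row /c pickleK.
exists c; apply/funext => k; apply/val_inj => /=.
have RI (z : R[i]) : complex.Re z +i* complex.Im z = z by case: z.
by rewrite !rc !dE /= RI clip_id //; have := valP (x k); rewrite inE.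
Qed.

Lemma shift_space_compact : compact [set: X].
Proof.
have [p cp sp] := cantor_shift_space_surj.
have -> : [set: X] = p @` setT.
  by apply/seteqP; split => // x _; have [c <-] := sp x; exists c.
apply: continuous_compact; last exact: cantor_space_compact.
exact: continuous_subspaceT.
Qed.

Lemma shift_space_hausdorff : hausdorff_space X.
Proof.
apply: (@hausdorff_product int (fun _ => unit_disc R)) => _.
apply: (@hausdorff_inj (unit_disc R) R[i]^o val); [exact: initial_continuous|exact: val_inj|].
exact: norm_hausdorff.
Qed.

End cantor_cover.

(** * Measures are determined by continuous functions *)

Section borel.
Variable R : realType.
Local Notation X := (shift_space R).

Lemma open_measurable_shift_space (U : set X) : open U -> measurable U.
Proof. by move=> oO; apply: sub_sigma_algebra. Qed.

Lemma continuous_measurable_real (F : X -> R) :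
  continuous F -> measurable_fun [set: X] F.
Proof.
move=> cF; apply: (measurability _ (@RGenOpens.measurableE R)) => _ [_ [a [b ->] <-]].
rewrite setTI; apply: open_measurable_shift_space.
by apply: open_comp => //; exact: interval_open.
Qed.

Lemma continuous_measurable_self (F : X -> X) :
  continuous F -> measurable_fun [set: X] F.
Proof.
move=> cF; have H := @measurability _ _ X X setT F (@open X) erefl.
apply: H; move=> _ [B oB <-].
by rewrite setTI; apply: open_measurable_shift_space; apply: open_comp.
Qed.

Lemma continuous_bounded (F : X -> R) :
  continuous F -> exists2 C, 0 <= C & forall x, `|F x| <= C.
Proof.
move=> cF.
have : compact (F @` [set: X]).
  apply: continuous_compact; last exact: shift_space_compact.
  exact: continuous_subspaceT.
move=> /compact_bounded[M [_ MF]].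
exists (Num.max 0 (M + 1)); first by rewrite le_max lexx.
by move=> x; rewrite le_max (MF (M + 1) _ (F x)) ?orbT ?ltrDl//; exists x.
Qed.

Lemma integrable_bounded (m : {measure set X -> \bar R}) (F : X -> R) (C : R) :
  (m setT < +oo)%E -> measurable_fun [set: X] F -> (forall x, `|F x| <= C) ->
  m.-integrable [set: X] (EFin \o F).
Proof.
move=> mT mF FC; apply: measurable_bounded_integrable => //.
by exists C; split; rewrite ?num_real// => M CM x _; exact: le_trans (FC x) (ltW CM).
Qed.

(** The sets are images of finite unions of clopen subsets of the Cantor space,
hence compact. *)
Lemma open_exhaustion (U : set X) : open U -> exists C : (set X)^nat,
  [/\ forall n, closed (C n), forall n, C n `<=` U,
      forall n m, (n <= m)%N -> C n `<=` C m & U `<=` \bigcup_n C n].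
Proof.
move=> oU; have [p cp sp] := cantor_shift_space_surj R.
have [K cK KU] := open_cantor_bigcup R (open_comp (fun c _ => cp c) oU).
exists (fun n => p @` (\big[setU/set0]_(i < n.+1) K i)); split.
- move=> n; apply: compact_closed; first exact: shift_space_hausdorff.
  apply: continuous_compact; first exact: continuous_subspaceT.
  apply: (subclosed_compact _ cantor_space_compact) => //.
  by apply: closed_bigsetU => i _; have [] := cK i.
- move=> n _ [c + <-]; rewrite -bigcup_mkord => -[k _ Kc].
  by rewrite -[U _]/((p @^-1` U) c) -KU; exists k.
- by move=> n m nm; apply: image_subset; apply: subset_bigsetU.
- move=> x Ux; have [c cx] := sp x.
  have : (p @^-1` U) c by rewrite /= cx.
  rewrite -KU => -[n _ Kn].
  by exists n => //; exists c => //; rewrite -bigcup_mkord; exists n => /=.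
Qed.

(** Urysohn functions between the sets of an exhaustion and the complement. *)
Lemma indic_open_limit (U : set X) : open U -> exists F : nat -> X -> R,
  [/\ forall n, continuous (F n), forall n x, `|F n x| <= 1
    & forall x, \forall n \near \oo, F n x = \1_U x].
Proof.
move=> oU; have [C [cC CU Cinc UC]] := open_exhaustion oU.
have nX : normal_space X.
  by apply: compact_normal; [exact: shift_space_hausdorff|exact: shift_space_compact].
have /choice[F FE] : forall n, exists F : X -> R, [/\ continuous F,
    range F `<=` `[0, 1], F @` (~` U) `<=` [set 0] & F @` (C n) `<=` [set 1]].
  move=> n; apply/uniform_separatorP; apply: (@normal_separatorP R X).1 => //.
    exact: open_closedC.
  by apply/seteqP; split => // x [? /CU].
exists F; split => [n|n x|x]; first by have [] := FE n.
  have [_ /(_ (F n x)) + _ _] := FE n.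
  rewrite /= in_itv /= => /(_ (ex_intro2 _ _ x I erefl))/andP[F0 F1].
  by rewrite ger0_norm.
rewrite indicE; have [xU|xU] := boolP (x \in U).
  have [n _ nx] := UC _ (set_mem xU); exists n => // k /= nk.
  have [_ _ _ h] := FE k; apply: h.
  by exists x => //; exact: (Cinc _ _ nk).
apply: nearW => k; have [_ _ h _] := FE k; apply: h.
by exists x => // Ux; move: xU; rewrite mem_set.
Qed.

(** Open sets form a pi-system, and their indicators are bounded limits of
continuous functions. *)
Lemma measure_ext (m1 m2 : {measure set X -> \bar R}) :
  (m1 setT < +oo)%E -> (m2 setT < +oo)%E ->
  (forall F : X -> R, continuous F -> \int[m1]_x F x = \int[m2]_x F x) ->
  forall A, measurable A -> m1 A = m2 A.
Proof.
move=> m1T m2T m12 A mA.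
apply: (measure_unique (@open X) (fun=> setT)) => //.
- exact: (@openI X).
- by move=> _; exact: openT.
- by apply/seteqP; split => // x _; exists 0%N.
move=> U oU; have [F [cF F1 FU]] := indic_open_limit oU.
have mF n := continuous_measurable_real (cF n).
have lim (m : {measure set X -> \bar R}) : (m setT < +oo)%E ->
    (fun n => \int[m]_x (F n x)%:E)%E @ \oo --> m U.
  move=> mT.
  have -> : m U = (\int[m]_x (\1_U x)%:E)%E.
    rewrite integral_indic ?setIT//; exact: open_measurable_shift_space.
  have := @dominated_convergence _ X R m setT measurableT
     (fun n x => (F n x)%:E) (fun x => (\1_U x)%:E) (cst 1%E).
  case => //.
  - by move=> n; apply/measurable_EFinP.
  - apply/measurable_EFinP/measurable_indic; exact: open_measurable_shift_space.
  - apply: aeW => x _; apply: cvg_EFin; first by apply: nearW.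
    exact: cvg_near_cst (FU x).
  - by apply: (@integrable_bounded m (cst 1) 1) => // x; rewrite normr1.
  - by apply: aeW => x n _; rewrite abse_EFin lee_fin.
have fin (m : {measure set X -> \bar R}) n : (m setT < +oo)%E ->
    (\int[m]_x (F n x)%:E)%E \is a fin_num.
  by move=> mT; apply: integrable_fin_num => //; exact: (@integrable_bounded _ _ 1).
have E n : (\int[m1]_x (F n x)%:E = \int[m2]_x (F n x)%:E)%E.
  by rewrite -(fineK (fin _ n m1T)) -(fineK (fin _ n m2T)); congr EFin; exact: m12.
have l1 := lim _ m1T.
have l2 := lim _ m2T; rewrite -(funext E) in l2.
by rewrite -(cvg_lim _ l1)// -(cvg_lim _ l2).
Qed.

End borel.

(** * Means and diagonal extraction *)

Section mean.
Variable R : realType.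

(** Finitely additive averaging on all functions.  Since no measurability is
involved, a mean can be lifted along any section of a surjection. *)
Definition mean (T : Type) (L : (T -> R) -> R) : Prop :=
  [/\ forall a F G, L (fun x => a * F x + G x) = a * L F + L G,
      forall F, (forall x, 0 <= F x) -> 0 <= L F
    & L (fun=> 1) = 1].

Section theory.
Variables (T : Type) (L : (T -> R) -> R).
Hypothesis mL : mean L.

Lemma mean0 : L (fun=> 0) = 0.
Proof.
have [lin _ _] := mL; have := lin (-1) (fun=> 0) (fun=> 0).
by rewrite mulr0 addr0 mulN1r addNr.
Qed.

Lemma meanD F G : L (fun x => F x + G x) = L F + L G.
Proof.
have [lin _ _] := mL; have := lin 1 F G; rewrite mul1r => <-.
by congr L; apply/funext => x; rewrite mul1r.
Qed.

Lemma meanZ a F : L (fun x => a * F x) = a * L F.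
Proof.
have [lin _ _] := mL; have := lin a F (fun=> 0); rewrite mean0 addr0 => <-.
by congr L; apply/funext => x; rewrite addr0.
Qed.

Lemma meanB F G : L (fun x => F x - G x) = L F - L G.
Proof.
rewrite -mulN1r -meanZ -meanD; congr L; apply/funext => x; by rewrite mulN1r.
Qed.

Lemma mean_cst a : L (fun=> a) = a.
Proof.
have [_ _ L1] := mL; rewrite -[RHS]mulr1 -L1 -meanZ; congr L.
by apply/funext => x; rewrite mulr1.
Qed.

Lemma le_mean F G : (forall x, F x <= G x) -> L F <= L G.
Proof.
have [_ pos _] := mL => FG; rewrite -subr_ge0 -meanB.
by apply: pos => x; rewrite subr_ge0.
Qed.

Lemma mean_norm_le F C : (forall x, `|F x| <= C) -> `|L F| <= C.
Proof.
move=> FC; rewrite ler_norml -{1}(mean_cst (- C)) -{2}(mean_cst C).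
by apply/andP; split; apply: le_mean => x; move: (FC x); rewrite ler_norml => /andP[].
Qed.

Lemma mean_comp (S : Type) (s : T -> S) : mean (fun h => L (h \o s)).
Proof.
have [lin pos L1] := mL; split => //.
- by move=> a F G; rewrite -lin.
- by move=> F F0; apply: pos => x; exact: F0.
Qed.

End theory.

(** A cluster point of the sequence in the compact space [0, 1]^nat gives the
limits: at stage [k] one picks an index at which the first [k] coordinates are
within [1 / k.+1] of it. *)
Lemma diagonal_extraction (b : nat -> nat -> R) :
  (forall n i, 0 <= b n i <= 1) ->
  exists (phi : nat -> nat) (l : nat -> R), {homo phi : i j / (i < j)%N} /\
    forall i, (fun n => b (phi n) i) @ \oo --> l i.
Proof.
move=> b01.
have cpt := @tychonoff nat (fun=> R) (fun=> `[0, 1]%classic) (fun=> @segment_compact R 0 1).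
pose P : topologicalType := prod_topology (fun _ : nat => R).
have [|l [_ cl]] := cpt ((b : nat -> P) @ \oo) _.
  by exists 0%N => // n _ i /=; rewrite in_itv /= b01.
have ex k N : exists n, (N <= n)%N /\ forall i, (i <= k)%N -> `|l i - b n i| < k.+1%:R^-1.
  have k0 : 0 < k.+1%:R^-1 :> R by rewrite invr_gt0.
  pose V (i : 'I_k.+1) : set P := fun f => `|l i - (f : nat -> R) i| < k.+1%:R^-1.
  have nV : \forall f \near nbhs (l : P), forall i, V i f.
    apply: filter_forall => i; have := @continuous_proj nat (fun=> R) i l.
    by move=> /cvgrPdist_lt /(_ _ k0).
  have [f [[n Nn <-] fV]] : ([set (b : nat -> P) n | n in [set n | (N <= n)%N]] `&`
      [set f | forall i, V i f]) !=set0.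
    by apply: cl => //; exists N => // n /= Nn; exists n.
  exists n; split => // i ik; exact: (fV (@Ordinal k.+1 i ik)).
have /choice[g gP] : forall kN : nat * nat, exists n, (kN.2 <= n)%N /\
  forall i, (i <= kN.1)%N -> `|l i - b n i| < kN.1.+1%:R^-1.
  by move=> [k N]; exact: ex.
pose phi := fix phi k := if k is k'.+1 then g (k, (phi k').+1) else g (0, 0)%N.
exists phi, l; split.
  apply: homo_ltn; first exact: ltn_trans.
  by move=> k /=; have [] := gP (k.+1, (phi k).+1).
have phiP k i : (i <= k)%N -> `|l i - b (phi k) i| < k.+1%:R^-1.
  case: k => [|k] ik; first by have [_] := gP (0, 0)%N; apply.
  by have [_] := gP (k.+1, (phi k).+1); apply.
move=> i; apply/cvgrPdist_lt => e e0.
near=> n; apply: lt_trans (phiP n i _) _; first by near: n; exact: nbhs_infty_ge.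
near: n; exact: (near_infty_natSinv_lt (PosNum e0)).
Unshelve. all: by end_near. Qed.

End mean.

(** * From contents on clopen sets to probabilities *)

Definition clopen_algebra : Type := cantor_space.
HB.instance Definition _ := Pointed.on clopen_algebra.
HB.instance Definition _ := @isAlgebraOfSets.Build default_measure_display
  clopen_algebra (@clopen cantor_space) (@clopen0 cantor_space)
  (@clopenU cantor_space) (fun A => @clopenC cantor_space A set0).

(** These are the Borel sets, open sets being countable unions of clopen sets. *)
Definition cantor_borel : Type := g_sigma_algebraType (@measurable _ clopen_algebra).
HB.instance Definition _ := Measurable.on cantor_borel.

Lemma probability_of_measure d (T : measurableType d) (R : realType)
    (m : {measure set T -> \bar R}) : m setT = 1%E ->
  exists P : probability T R, forall A, P A = m A.
Proof.
move=> m1; exists (mnormalize m (@dirac _ T point R)) => A.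
by rewrite /= /mnormalize m1 onee_eq0 /= invr1 mule1.
Qed.

Section content.
Variable R : realType.
Variable c : set cantor_space -> R.
Hypothesis c_ge0 : forall A, clopen A -> 0 <= c A.
Hypothesis cU : forall A B, clopen A -> clopen B -> A `&` B = set0 ->
  c (A `|` B) = c A + c B.

Let c0 : c set0 = 0.
Proof.
have := cU (@clopen0 cantor_space) (@clopen0 cantor_space) (setI0 set0).
by rewrite setU0 => /eqP; rewrite -subr_eq0 opprD addNKr oppr_eq0 => /eqP.
Qed.

(** Cutting at 0 makes the content nonnegative on all sets, whatever the values
of [c] off the clopen sets. *)
Definition clopen_content (A : set clopen_algebra) : \bar R := (Num.max 0 (c A))%:E.

Lemma clopen_contentE A : clopen (A : set cantor_space) -> clopen_content A = (c A)%:E.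
Proof. by move=> cA; rewrite /clopen_content max_r// c_ge0. Qed.

Lemma clopen_content_bigsetU (F : (set cantor_space)^nat) (n : nat) :
  (forall i, clopen (F i)) -> trivIset setT F ->
  clopen (\big[setU/set0]_(0 <= i < n) F i) /\
  c (\big[setU/set0]_(0 <= i < n) F i) = \sum_(0 <= i < n) c (F i).
Proof.
move=> cF tF; elim: n => [|n [IHc IH]].
  by rewrite !big_nil; split => //; exact: clopen0.
rewrite !big_nat_recr//=; split; first exact: clopenU.
rewrite cU ?IH//; apply/seteqP; split => // x [].
rewrite big_mkord -bigcup_mkord => -[k /= kn Fk] Fn.
by have := tF k n I I (ex_intro _ x (conj Fk Fn)) => kE; rewrite kE ltnn in kn.
Qed.

(** A clopen set that is a disjoint union of clopen sets is, by compactness, the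
union of finitely many of them, and the others are empty. *)
Lemma clopen_content_sigma_additive : semi_sigma_additive clopen_content.
Proof.
move=> F mF tF mUF.
have cptU : compact (\bigcup_n F n : set cantor_space).
  by apply: (subclosed_compact _ cantor_space_compact) => //; have [] := mUF.
move: cptU; rewrite compact_cover => /(_ nat setT F)[|//|D _ cov].
  by move=> i _; have [] := mF i.
apply: cvg_near_cst; exists (\max_(i <- finmap.enum_fset D) i).+1 => // n /= nD.
have -> : (\bigcup_n F n : set clopen_algebra) = \big[setU/set0]_(0 <= i < n) F i.
  apply/seteqP; split => x; rewrite big_mkord -bigcup_mkord; last by case=> i _ Fi; exists i.
  move=> /cov[i iD Fi]; exists i => //=; apply: leq_ltn_trans nD.
  exact: (@leq_bigmax_seq _ _ xpredT id i).
have [cl clE] := clopen_content_bigsetU n mF tF.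
rewrite clopen_contentE// clE -sumEFin.
by apply: eq_bigr => i _; rewrite clopen_contentE//; exact: mF.
Qed.

Lemma clopen_content0 : clopen_content set0 = 0%E.
Proof. by rewrite clopen_contentE ?c0//; exact: clopen0. Qed.

Lemma clopen_content_ge0 A : (0 <= clopen_content A)%E.
Proof. by rewrite /clopen_content lee_fin le_max lexx. Qed.

HB.instance Definition _ := isMeasure.Build _ clopen_algebra R clopen_content
  clopen_content0 clopen_content_ge0 clopen_content_sigma_additive.

Lemma content_measure : c setT = 1 -> exists m : probability cantor_borel R,
  forall A, clopen (A : set cantor_space) -> m A = (c A)%:E.
Proof.
move=> c1.
have E A : clopen (A : set cantor_space) -> measure_extension clopen_content A = (c A)%:E.
  by move=> cA; rewrite /measure_extension measurable_mu_extE//; exact: clopen_contentE.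
have [|P PE] := @probability_of_measure _ _ R (measure_extension clopen_content : {measure set cantor_borel -> \bar R}).
  by apply: etrans (E setT _) _; [exact: clopenT|rewrite c1].
by exists P => A cA; rewrite PE; exact: E.
Qed.

End content.

(** * Weak-star sequential compactness *)

Section compactness.
Variable R : realType.
Local Notation X := (shift_space R).

Lemma open_measurable_cantor (U : set cantor_space) : open U ->
  measurable (U : set cantor_borel).
Proof.
move=> /(open_cantor_bigcup R)[K cK <-]; apply: bigcupT_measurable => n.
by apply: sub_sigma_algebra; exact: cK.
Qed.

Lemma continuous_measurable_cantor (h : cantor_space -> R) :
  continuous h -> measurable_fun [set: cantor_borel] (h : cantor_borel -> R).
Proof.
move=> ch; apply: (measurability _ (@RGenOpens.measurableE R)) => _ [_ [a [b ->] <-]].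
rewrite setTI; apply: open_measurable_cantor.
by apply: open_comp => //; exact: interval_open.
Qed.

Section limit.
Variables (M : nat -> (cantor_space -> R) -> R) (m : probability cantor_borel R).
Hypothesis meanM : forall k, mean (M k).
Hypothesis Mm : forall A : set cantor_space, clopen A ->
  (fun k => M k \1_A) @ \oo --> fine (m A).

(** The functions whose means converge to their integral; they form a vector
space that contains the indicators of clopen sets. *)
Let good (h : cantor_space -> R) : Prop :=
  [/\ measurable_fun [set: cantor_borel] (h : cantor_borel -> R),
      exists C, forall c, `|h c| <= C
    & (fun k => M k h) @ \oo --> \int[m]_(c in [set: cantor_borel]) h c].

Let mT : fine (m [set: cantor_borel]) = 1.
Proof. by rewrite (_ : m _ = 1%E)//; exact: probability_setT. Qed.

Let integrable_good h C : measurable_fun [set: cantor_borel] (h : cantor_borel -> R) ->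
  (forall c, `|h c| <= C) -> m.-integrable [set: cantor_borel] (EFin \o h).
Proof.
move=> mh hC; apply: measurable_bounded_integrable => //.
  by apply: le_lt_trans (probability_le1 _ _) _; rewrite ?ltry.
by exists C; split; rewrite ?num_real// => N CN x _; exact: le_trans (hC x) (ltW CN).
Qed.

Let good_indic A : clopen A -> good \1_A.
Proof.
move=> cA; have mA : measurable (A : set cantor_borel) by apply: open_measurable_cantor; case: cA.
split; first exact: measurable_indic.
  by exists 1 => c; rewrite indicE; case: (c \in A); rewrite ?normr1 ?normr0.
rewrite /Rintegral integral_indic// setIT; exact: Mm.
Qed.

Let good0 : good (fun=> 0).
Proof.
split; first exact: measurable_cst.
  by exists 0 => c; rewrite normr0.
rewrite Rintegral_cst// mul0r; under eq_fun do rewrite mean0//; exact: cvg_cst.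
Qed.

Let goodD a h1 h2 : good h1 -> good h2 -> good (fun c => h1 c + a * h2 c).
Proof.
move=> [m1 [C1 b1] l1] [m2 [C2 b2] l2]; split.
- by apply: measurable_funD => //; apply: measurable_funM.
- exists (C1 + `|a| * C2) => c; apply: le_trans (ler_normD _ _) _.
  by rewrite lerD// normrM ler_wpM2l.
have i1 := integrable_good m1 b1; have i2 := integrable_good m2 b2.
rewrite RintegralD//; last first.
  apply: (@integrable_good _ (`|a| * C2)); first exact: measurable_funM.
  by move=> c; rewrite normrM ler_wpM2l.
rewrite RintegralZl//; under eq_fun do rewrite (meanD (meanM _)) (meanZ (meanM _)).
by apply: cvgD => //; apply: cvgMr.
Qed.

Let good_approx (h : cantor_space -> R) (e : R) : continuous h -> 0 < e ->
  exists2 q, good q & forall c, `|h c - q c| < e.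
Proof.
move=> ch e0.
have /choice[D DP] : forall c0 : cantor_space, exists D : set cantor_space,
    [/\ D c0, clopen D & forall c, D c -> `|h c - h c0| < e].
  move=> c0; have : nbhs c0 [set c | `|h c0 - h c| < e] by move/cvgrPdist_lt: (ch c0); apply.
  move/(zero_dimensional_cvg cantor_space_hausdorff cantor_zero_dimensional
    cantor_space_compact) => [D [Dc cD] DO].
  by exists D; split => // c /DO /=; rewrite distrC.
have := cantor_space_compact; rewrite compact_cover => /(_ cantor_space setT D)[c0 _|c _|F _ cov].
- by have [_ []] := DP c0.
- by exists c => //; have [] := DP c.
(* Induction on the finite cover: [q] approximates [h] on the union [V] of the sets met so far and vanishes off [V], so a new set only matters outside [V]. *)
suff [q gq [V [cV FV Vq _]]] : exists2 q, good q & exists V, [/\ clopen V,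
    forall c c0, c0 \in finmap.enum_fset F -> D c0 c -> V c,
    forall c, V c -> `|h c - q c| < e & forall c, ~ V c -> q c = 0].
  by exists q => // c; have [c0 c0F Dc] := cov c I; exact: Vq (FV _ _ c0F Dc).
elim: (finmap.enum_fset F) => [|c0 s [q gq [V [cV FV Vq q0]]]].
  by exists (fun=> 0) => //; exists set0; split => //; exact: clopen0.
have [Dc0 cD hD] := DP c0.
have cDV : clopen (D c0 `&` ~` V) by apply: clopenI => //; exact: clopenC.
exists (fun c => q c + h c0 * \1_(D c0 `&` ~` V) c).
  by apply: goodD => //; exact: good_indic.
exists (V `|` D c0); split.
- exact: clopenU.
- move=> c c1; rewrite inE => /orP[/eqP->|c1s Dc]; first by right.
  by left; exact: FV c1s Dc.
- move=> c VDc; rewrite indicE; have [Vc|Vc] := pselect (V c).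
    rewrite memNset ?mulr0 ?addr0; last by case.
    exact: Vq.
  rewrite mem_set; last by split => //; case: VDc.
  by rewrite q0// add0r mulr1 hD//; case: VDc.
- move=> c /not_orP[Vc Dc]; rewrite indicE memNset; last by case.
  by rewrite q0// mulr0 addr0.
Qed.

(** A continuous function is a uniform limit of combinations of indicators of
clopen sets, and both sides are 1-Lipschitz for the uniform norm. *)
Lemma mean_cvg_integral (h : cantor_space -> R) : continuous h ->
  (fun k => M k h) @ \oo --> \int[m]_(c in [set: cantor_borel]) h c.
Proof.
move=> ch; apply/cvgrPdist_lt => e e0; have e30 : 0 < e / 3 by rewrite divr_gt0.
have mh := continuous_measurable_cantor ch.
have [q [mq [C qC] lq] hq] := good_approx ch e30.
have iq := integrable_good mq qC.
have ih : m.-integrable [set: cantor_borel] (EFin \o h).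
  apply: (@integrable_good _ (C + e / 3)) => // c.
  by rewrite -(subrK (q c) (h c)) addrC (le_trans (ler_normD _ _))// lerD// ltW.
have I1 : `|\int[m]_(c in [set: cantor_borel]) h c -
            \int[m]_(c in [set: cantor_borel]) q c| <= e / 3.
  rewrite -RintegralB//.
  have mhq : measurable_fun [set: cantor_borel] (fun c : cantor_borel => h c - q c).
    exact: measurable_funB.
  apply: le_trans (le_normr_Rintegral _ _) _ => //.
    by apply: (@integrable_good _ (e / 3)) => // c; exact: ltW.
  have -> : e / 3 = \int[m]_(c in [set: cantor_borel]) cst (e / 3) c.
    by rewrite Rintegral_cst// mT mulr1.
  apply: le_Rintegral => //.
  - apply: (@integrable_good _ (e / 3)); first exact: measurableT_comp.
    by move=> c; rewrite normr_id ltW.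
  - by apply: (@integrable_good _ (e / 3)) => // c; rewrite ger0_norm// ltW.
  - by move=> c _; exact: ltW.
near=> k.
have I2 : `|M k h - M k q| <= e / 3.
  by rewrite -meanB//; apply: mean_norm_le => // c; exact: ltW.
have I3 : `|\int[m]_(c in [set: cantor_borel]) q c - M k q| < e / 3.
  by near: k; move/cvgrPdist_lt: lq; apply.
apply: le_lt_trans (ler_distD (\int[m]_(c in [set: cantor_borel]) q c) _ _) _.
apply: le_lt_trans (lerD I1 (ler_distD (M k q) _ _)) _.
rewrite distrC in I2; move: I1 I2 I3; lra.
Unshelve. all: by end_near. Qed.

End limit.
End compactness.

Section image_probability.
Context d d' (T : measurableType d) (T' : measurableType d') (R : realType).
Variables (m : probability T R) (f : T -> T') (mf : measurable_fun setT f).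

Let f_mixin := isMeasurableFun.Build _ _ _ _ _ mf.
Let f_mfun : {mfun T >-> T'} := MeasurableFun.Pack (MeasurableFun.Class f_mixin).

(** The law of [f], packaged for an explicit proof of measurability. *)
Definition image_probability : probability T' R := distribution m f_mfun.

Lemma image_probabilityE A : image_probability A = m (f @^-1` A).
Proof. by []. Qed.

Lemma Rintegral_image_probability (F : T' -> R) (C : R) :
  measurable_fun setT F -> (forall x, `|F x| <= C) ->
  \int[image_probability]_x F x = \int[m]_x F (f x).
Proof.
move=> mF FC; rewrite /Rintegral; congr fine.
apply: (@integral_distribution _ _ _ _ _ m f_mfun (EFin \o F)).
  exact/measurable_EFinP.
apply: measurable_bounded_integrable => //.
- by apply: le_lt_trans (probability_le1 _ _) _; rewrite ?ltry.
- exact: measurableT_comp.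
- by exists C; split; rewrite ?num_real// => N CN x _; exact: le_trans (FC _) (ltW CN).
Qed.

End image_probability.

Section compactness.
Variable R : realType.
Local Notation X := (shift_space R).

(** The means are lifted along a section of the surjection from the Cantor
space, where their limit on clopen sets defines a measure; its image is the
limit. *)
Theorem weak_star_compact (L : nat -> (X -> R) -> R) : (forall k, mean (L k)) ->
  exists (phi : nat -> nat) (mu : probability X R), {homo phi : i j / (i < j)%N} /\
    forall F : X -> R, continuous F -> (fun k => L (phi k) F) @ \oo --> \int[mu]_x F x.
Proof.
move=> mL; have [p cp sp] := cantor_shift_space_surj R.
have [s sK] := choice sp.
pose M k (h : cantor_space -> R) := L k (h \o s).
have mM k : mean (M k) by apply: mean_comp.
have [e eclo esurj] := clopen_enum R.
have indic01 (A : set cantor_space) c : 0 <= (\1_A c : R) <= 1.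
  by rewrite indicE; case: (c \in A); rewrite lexx ler01.
have [|phi [l [phi_incr phil]]] := @diagonal_extraction R (fun n i => M n \1_(e i)).
  move=> n i; rewrite -{1}(mean_cst (mM n) 0) -(mean_cst (mM n) 1).
  by apply/andP; split; apply: le_mean => // c; have /andP[] := indic01 (e i) c.
pose c A := limn (fun k => M (phi k) \1_A).
have cE A : clopen A -> (fun k => M (phi k) \1_A) @ \oo --> c A.
  by move=> /esurj[i <-]; rewrite /c (cvg_lim _ (phil i)).
have [| | |m mE] := @content_measure R c.
- move=> A cA; apply: (limr_ge (cvgP _ (cE _ cA))); apply: nearW => k.
  by have [_ pos _] := mM (phi k); apply: pos => d; have /andP[] := indic01 A d.
- move=> A B cA cB AB; apply/cvg_lim => //.
  have -> : (fun k => M (phi k) \1_(A `|` B)) = (fun k => M (phi k) \1_A + M (phi k) \1_B).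
    apply/funext => k; rewrite -meanD//; congr (M _); apply/funext => d.
    rewrite !indicE in_setU; have := congr1 (fun V : set _ => d \in V) AB.
    by rewrite in_setI in_set0; case: (d \in A); case: (d \in B) => //=; rewrite ?addr0 ?add0r.
  by apply: cvgD; exact: cE.
- rewrite /c indicT; under eq_fun do rewrite (mean_cst (mM _)).
  exact: lim_cst.
have mp : measurable_fun [set: cantor_borel] (p : cantor_borel -> X).
  have H := @measurability _ _ cantor_borel X setT p (@open X) erefl.
  apply: H; move=> _ [B oB <-].
  rewrite setTI; apply: (open_measurable_cantor R); exact: open_comp.
exists phi, (image_probability m mp); split => // F cF.
have [C _ FC] := continuous_bounded cF.
rewrite (Rintegral_image_probability _ _ (continuous_measurable_real cF) FC).
have := @mean_cvg_integral R (fun k => M (phi k)) m (fun k => mM (phi k)) _ (F \o p).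
rewrite /M /=.
have -> : (F \o p) \o s = F by apply/funext => x /=; rewrite sK.
apply.
  by move=> A cA; rewrite mE//=; exact: cE.
by move=> d; apply: continuous_comp; [exact: cp|exact: cF].
Qed.

End compactness.

(** * The circle *)

Section circle.
Variable R : realType.
Local Open Scope complex_scope.

Lemma circle_expD (s t : R) : circle_exp (s + t) = circle_exp s * circle_exp t.
Proof.
apply/eqP; rewrite eq_complex /= mulrDr cosD sinD eqxx /=; apply/eqP; ring.
Qed.

Lemma circle_exp0 : circle_exp (0 : R) = 1.
Proof. by rewrite /circle_exp mulr0 cos0 sin0. Qed.

Lemma circle_exp1 : circle_exp (1 : R) = 1.
Proof. by rewrite /circle_exp mulr1 mulrC mulr_natr cos2pi sin2pi. Qed.

Lemma circle_exp_nat (n : nat) : circle_exp (n%:R : R) = 1.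
Proof.
elim: n => [|n IH]; first exact: circle_exp0.
by rewrite -natr1 circle_expD IH circle_exp1 mulr1.
Qed.

Lemma circle_expX (t : R) n : circle_exp t ^+ n = circle_exp (n%:R * t).
Proof.
elim: n => [|n IH]; first by rewrite mul0r circle_exp0 expr0.
by rewrite exprSr IH -circle_expD -natr1 mulrDl mul1r.
Qed.

Lemma normc_circle_exp (t : R) : normc (circle_exp t) = 1.
Proof. by rewrite /circle_exp /normc cos2Dsin2 sqrtr1. Qed.

Lemma circle_exp_neq0 (t : R) : circle_exp t != 0.
Proof.
apply/eqP => e0; have := normc_circle_exp t; rewrite e0 normc0 => /eqP.
by rewrite eq_sym oner_eq0.
Qed.

Lemma circle_expN (t : R) : circle_exp (- t) = (circle_exp t)^-1.
Proof.
apply: (mulIf (circle_exp_neq0 t)); rewrite mulVf ?circle_exp_neq0//.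
by rewrite -circle_expD addNr circle_exp0.
Qed.

(** [cos (2 pi t) = 1 - 2 (sin (pi t))^2], and the sine is positive on (0, pi). *)
Lemma circle_exp_neq1 (t : R) : 0 < t < 1 -> circle_exp t != 1.
Proof.
move=> /andP[t0 t1]; apply/eqP => /(congr1 (@complex.Re R)) /=.
have -> : 2 * pi * t = (pi * t) *+ 2 by ring.
rewrite cos_mulr2n cos2sin2 => e; have : sin (pi * t) ^+ 2 = 0 by lra.
move/eqP; rewrite expf_eq0 /= => /eqP s0.
have : 0 < sin (pi * t).
  by apply: sin_gt0_pi; rewrite mulr_gt0 ?pi_gt0//= gtr_pMr ?pi_gt0.
by rewrite s0 ltxx.
Qed.

Lemma sum_circle_exp (r j : nat) : (0 < j < r)%N ->
  \sum_(l < r) circle_exp (- (j%:R * (l%:R / r%:R)) : R) = 0.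
Proof.
move=> /andP[j0 jr]; have r0 : (r%:R : R) != 0 by rewrite pnatr_eq0 -lt0n (leq_trans _ jr).
pose z := (circle_exp (j%:R / r%:R : R))^-1.
have z1 : z != 1.
  rewrite invr_eq1; apply: circle_exp_neq1; rewrite divr_gt0 ?ltr0n ?(leq_trans _ jr)//=.
  by rewrite ltr_pdivrMr ?mul1r ?ltr_nat ?ltr0n ?(leq_trans _ jr).
have -> : \sum_(l < r) circle_exp (- (j%:R * (l%:R / r%:R)) : R) = \sum_(l < r) z ^+ l.
  apply: eq_bigr => l _; rewrite circle_expN exprVn circle_expX; congr (circle_exp _)^-1.
  by rewrite mulrA mulrCA mulrA.
have zr : z ^+ r = 1.
  by rewrite exprVn circle_expX mulrCA divff// mulr1 circle_exp_nat invr1.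
have : (z - 1) * \sum_(l < r) z ^+ l = 0 by rewrite -subrX1 zr subrr.
by move/eqP; rewrite mulf_eq0 subr_eq0 (negbTE z1) => /eqP.
Qed.

End circle.

(** * Measurable complex functions and invariant densities *)

Section complex_measurable.
Context d (T : measurableType d) (R : realType).
Local Open Scope complex_scope.

Definition cmeasurable (g : T -> R[i]) : Prop :=
  measurable_fun setT (fun x => complex.Re (g x)) /\
  measurable_fun setT (fun x => complex.Im (g x)).

Lemma cmeasurable_cst z : cmeasurable (fun=> z).
Proof. by split; exact: measurable_cst. Qed.

Lemma cmeasurableD g h : cmeasurable g -> cmeasurable h ->
  cmeasurable (fun x => g x + h x).
Proof.
move=> [g1 g2] [h1 h2]; split.
  rewrite [X in measurable_fun _ X](_ : _ = (fun x => complex.Re (g x) + complex.Re (h x))).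
    exact: measurable_funD.
  by apply/funext => x; case: (g x) (h x) => a b [c e].
rewrite [X in measurable_fun _ X](_ : _ = (fun x => complex.Im (g x) + complex.Im (h x))).
  exact: measurable_funD.
by apply/funext => x; case: (g x) (h x) => a b [c e].
Qed.

Lemma cmeasurableM g h : cmeasurable g -> cmeasurable h ->
  cmeasurable (fun x => g x * h x).
Proof.
move=> [g1 g2] [h1 h2]; split.
  rewrite [X in measurable_fun _ X](_ : _ = (fun x =>
      complex.Re (g x) * complex.Re (h x) - complex.Im (g x) * complex.Im (h x))).
    by apply: measurable_funB; exact: measurable_funM.
  by apply/funext => x; case: (g x) (h x) => a b [c e].
rewrite [X in measurable_fun _ X](_ : _ = (fun x =>
    complex.Re (g x) * complex.Im (h x) + complex.Im (g x) * complex.Re (h x))).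
  by apply: measurable_funD; exact: measurable_funM.
by apply/funext => x; case: (g x) (h x) => a b [c e].
Qed.

Lemma cmeasurable_sum n (g : nat -> T -> R[i]) : (forall i, cmeasurable (g i)) ->
  cmeasurable (fun x => \sum_(i < n) g i x).
Proof.
move=> mg; elim: n => [|n IH].
  by under eq_fun do rewrite big_ord0; exact: cmeasurable_cst.
by under eq_fun do rewrite big_ord_recr; exact: cmeasurableD.
Qed.

Lemma cmeasurable_real (u : T -> R) : measurable_fun setT u ->
  cmeasurable (fun x => (u x)%:C).
Proof. by move=> mu; split => //; exact: measurable_cst. Qed.

Lemma measurable_ceq (g h : T -> R[i]) : cmeasurable g -> cmeasurable h ->
  measurable [set x | g x = h x].
Proof.
move=> [g1 g2] [h1 h2].
have -> : [set x | g x = h x] = [set x | complex.Re (g x) = complex.Re (h x)] `&`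
    [set x | complex.Im (g x) = complex.Im (h x)].
  apply/seteqP; split => [x /= -> //|x /=].
  by case: (g x) (h x) => a b [c e] /= [-> ->].
have eqm (u v : T -> R) : measurable_fun setT u -> measurable_fun setT v ->
    measurable [set x | u x = v x].
  move=> mu mv; have -> : [set x | u x = v x] = setT `&` (fun x => u x == v x) @^-1` [set true].
    by rewrite setTI; apply/seteqP; split => x /= /eqP.
  exact: measurable_fun_eqr.
by apply: measurableI; exact: eqm.
Qed.

End complex_measurable.

Lemma cmeasurable_comp d d' (T : measurableType d) (T' : measurableType d')
    (R : realType) (g : T' -> R[i]) (f : T -> T') :
  cmeasurable g -> measurable_fun setT f -> cmeasurable (fun x => g (f x)).
Proof. by move=> [g1 g2] mf; split; [exact: (measurableT_comp g1 mf)|exact: (measurableT_comp g2 mf)]. Qed.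

Section density.
Context d (T : measurableType d) (R : realType).
Variables mu nu : probability T R.
Hypothesis numu : forall A, measurable A -> mu A = 0%E -> nu A = 0%E.

Lemma density_exists : exists phi : T -> R, [/\ forall x, 0 <= phi x,
  measurable_fun setT phi, mu.-integrable setT (EFin \o phi)
  & forall A, measurable A -> nu A = (\int[mu]_(x in A) (phi x)%:E)%E].
Proof.
have numu' : nu `<< mu by apply/null_content_dominatesP.
have [f [f0 ffin fint fE]] := radon_nikodym_sigma_finite numu'.
have fineE x : (fine (f x))%:E = f x by rewrite fineK.
exists (fine \o f); split.
- by move=> x; apply: fine_ge0.
- by apply: measurableT_comp => //; exact: measurable_int fint.
- by rewrite (_ : EFin \o _ = f)//; apply/funext => x /=.
- by move=> A mA; rewrite fE//; apply: eq_integral => x _ /=.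
Qed.

Variable phi : T -> R.
Hypothesis phi_ge0 : forall x, 0 <= phi x.
Hypothesis mphi : measurable_fun setT phi.
Hypothesis iphi : mu.-integrable setT (EFin \o phi).
Hypothesis phiE : forall A, measurable A -> nu A = (\int[mu]_(x in A) (phi x)%:E)%E.

Lemma density_null A : measurable A ->
  nu A = 0%E <-> {ae mu, forall x, A x -> phi x = 0}.
Proof.
move=> mA; rewrite phiE//.
have -> : (\int[mu]_(x in A) (phi x)%:E = \int[mu]_(x in A) `|(EFin \o phi) x|)%E.
  by apply: eq_integral => x _; rewrite /= ger0_norm.
rewrite (ae_eq_integral_abs mu mA); last by apply/measurable_EFinP; exact: measurable_funTS.
split; apply: filterS => x; first by move=> + Ax => /(_ Ax)[].
by move=> + Ax => /(_ Ax) /= ->.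
Qed.

(** Both measures being invariant under the invertible map [S], the density and
its composition with [S] have the same integral on every measurable set. *)
Lemma density_invariant (S S' : T -> T) :
  measurable_fun setT S -> measurable_fun setT S' -> cancel S S' -> cancel S' S ->
  (forall A, measurable A -> mu (S @^-1` A) = mu A) ->
  (forall A, measurable A -> nu (S @^-1` A) = nu A) ->
  {ae mu, forall x, phi (S x) = phi x}.
Proof.
move=> mS mS' SK S'K muS nuS.
have iphiS : mu.-integrable setT (EFin \o (phi \o S)).
  apply/integrableP; split; first by apply/measurable_EFinP; exact: measurableT_comp.
  have /integrableP[_] := iphi; apply: le_lt_trans.
  have := @ge0_integral_distribution _ _ _ _ _ mu (MeasurableFun.Pack (MeasurableFun.Class (isMeasurableFun.Build _ _ _ _ _ mS))) (fun x => `|(EFin \o phi) x|)%E.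
  move=> <- //; last by apply: measurableT_comp => //; exact/measurable_EFinP.
  by rewrite (@eq_measure_integral _ _ _ _ mu)// => A mA _; exact: muS.
have ae : ae_eq mu setT (EFin \o (phi \o S)) (EFin \o phi).
  apply: integral_ae_eq => //.
    by apply/measurable_EFinP; exact: mphi.
  move=> A _ mA; rewrite -phiE//.
  pose B := S' @^-1` A.
  have mB : measurable B by rewrite -[B]setTI; exact: mS'.
  have AE : A = S @^-1` B by apply/seteqP; split => x; rewrite /B /= SK.
  rewrite [in RHS]AE nuS// phiE// [in LHS]AE.
  have := @ge0_integral_pushforward _ _ _ _ _ S mS mu B (EFin \o phi) mB.
  move=> <-; [|by apply: measurable_funTS; exact/measurable_EFinP|by move=> x _; rewrite lee_fin].
  by apply: eq_measure_integral => C mC _; exact: muS.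
by apply: filterS ae => x /(_ I) [].
Qed.

End density.

(** * Roots of eigenvalues *)

Lemma ae_comp d (T : measurableType d) (R : realType) (mu : probability T R)
    (S : T -> T) (P : T -> Prop) :
  measurable_fun setT S -> (forall A, measurable A -> mu (S @^-1` A) = mu A) ->
  {ae mu, forall x, P x} -> {ae mu, forall x, P (S x)}.
Proof.
move=> mS muS [N [mN N0 PN]]; exists (S @^-1` N); split.
- by rewrite -[X in measurable X]setTI; exact: mS.
- by rewrite muS.
- by move=> x /= nP; exact: (PN (S x)).
Qed.

Section shift_maps.
Variable R : realType.
Local Notation X := (shift_space R).

Definition reindex (a : int -> int) (x : X) : X := fun k => x (a k).

Lemma continuous_reindex (a : int -> int) : continuous (reindex a).
Proof.
move=> x.
apply: (@cvg_prod_topology int (fun=> unit_disc R) X (nbhs x) (reindex a)).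
move=> k; exact: (@continuous_proj int (fun=> unit_disc R) (a k) x).
Qed.

Lemma iter_shiftE n (x : X) (k : int) : iter n (@Defs.shift R) x k = x (k + n%:Z).
Proof.
elim: n k => [|n IH] k; first by rewrite addr0.
rewrite iterS /Defs.shift IH; congr (x _); lia.
Qed.

Lemma continuous_iter_shift n : continuous (iter n (@Defs.shift R) : X -> X).
Proof.
have -> : iter n (@Defs.shift R) = reindex (fun k => k + n%:Z).
  by apply/funext => x; apply/funext => k; rewrite iter_shiftE.
exact: continuous_reindex.
Qed.

Lemma measurable_iter_shift n : measurable_fun setT (iter n (@Defs.shift R) : X -> X).
Proof. by apply: continuous_measurable_self; exact: continuous_iter_shift. Qed.

Definition unshift n : X -> X := reindex (fun k => k - n%:Z).

Lemma measurable_unshift n : measurable_fun setT (unshift n).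
Proof. by apply: continuous_measurable_self; exact: continuous_reindex. Qed.

Lemma iter_shiftK n : cancel (iter n (@Defs.shift R)) (unshift n).
Proof. by move=> x; apply/funext => k; rewrite /unshift /reindex iter_shiftE subrK. Qed.

Lemma unshiftK n : cancel (unshift n) (iter n (@Defs.shift R)).
Proof. by move=> x; apply/funext => k; rewrite iter_shiftE /unshift /reindex addrK. Qed.

End shift_maps.

Section discrete_fourier.
Variable R : realType.
Local Open Scope complex_scope.

(** The sum is rotated by one place; the term that leaves and the term that
enters agree by the relation between [a r] and [a 0]. *)
Lemma twisted_sum_shift (a : nat -> R[i]) (b : R) (r : nat) : (0 < r)%N ->
  a r = circle_exp (r%:R * b) * a 0%N ->
  \sum_(j < r) circle_exp (- (j%:R * b)) * a j.+1 =
  circle_exp b * \sum_(j < r) circle_exp (- (j%:R * b)) * a j.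
Proof.
case: r => // r _ ar.
rewrite big_ord_recr [in RHS]big_ord_recl /= mulrDr addrC; congr (_ + _).
  rewrite ar mul0r oppr0 circle_exp0 mul1r mulrA -circle_expD; congr (circle_exp _ * _).
  by rewrite -natr1 mulrDl mul1r; ring.
rewrite mulr_sumr; apply: eq_bigr => j _; rewrite mulrA -circle_expD /bump /= add1n.
by congr (circle_exp _ * _); rewrite -natr1; ring.
Qed.

(** Fourier inversion on Z/r: the sum over [l] of the characters kills every
[a j] but [a 0]. *)
Lemma sum_twisted_sums (a : nat -> R[i]) (alpha : R) (r : nat) : (0 < r)%N ->
  \sum_(l < r) \sum_(j < r) circle_exp (- (j%:R * ((alpha + l%:R) / r%:R))) * a j
  = r%:R * a 0%N.
Proof.
move=> r0; rewrite exchange_big /= (bigD1 (Ordinal r0))//= [X in _ + X]big1 ?addr0.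
  under eq_bigr do rewrite mul0r oppr0 circle_exp0 mul1r.
  by rewrite sumr_const card_ord mulr_natl.
move=> j j0; rewrite -mulr_suml.
have -> : \sum_(l < r) circle_exp (- (j%:R * ((alpha + l%:R) / r%:R))) =
    circle_exp (- (j%:R * (alpha / r%:R))) *
    \sum_(l < r) circle_exp (- (j%:R * (l%:R / r%:R))).
  rewrite mulr_sumr; apply: eq_bigr => l _; rewrite -circle_expD; congr circle_exp.
  by rewrite mulrDl mulrDr opprD.
rewrite sum_circle_exp ?mulr0 ?mul0r//.
by rewrite ltn_ord andbT lt0n; move: j0; apply: contra => /eqP j0; apply/eqP/val_inj.
Qed.

End discrete_fourier.

Section spectral_core.
Variable R : realType.
Local Notation X := (shift_space R).
Local Open Scope complex_scope.

Lemma Lfun2_bounded (mu : probability X R) (u : X -> R) :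
  measurable_fun setT u -> (forall x, `|u x| <= 1) -> u \in Lfun mu 2%:E.
Proof.
move=> mu_ u1; rewrite inE; apply/andP; split; rewrite inE//=.
rewrite /finite_norm unlock poweR_lty//.
apply: (@le_lt_trans _ _ (\int[mu]_x (cst 1%E) x)%E); last first.
  by rewrite integral_cst// mul1e (le_lt_trans (probability_le1 _ _)) ?ltry.
apply: ge0_le_integral => //.
- by move=> x _; exact: poweR_ge0.
- apply: (measurableT_comp (measurable_poweR _)).
  by apply: measurableT_comp => //; exact/measurable_EFinP.
- by move=> x _ /=; rewrite lee_fin powR_mulrn// expr_le1.
Qed.

(** Square integrability comes for free: [g / (1 + |g|^2)] is bounded, vanishes
where [g] does, and satisfies the same equation since [|g|] is invariant. *)
Lemma spectrum_intro (mu : probability X R) (alpha : R) (g : X -> R[i]) :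
  0 <= alpha < 1 -> cmeasurable g -> ~ {ae mu, forall x, g x = 0} ->
  {ae mu, forall x, g (Defs.shift x) = circle_exp alpha * g x} -> spectrum mu alpha.
Proof.
move=> a01 mg gn0 geig; split => //.
pose w x := (1 + complex.Re (g x) ^+ 2 + complex.Im (g x) ^+ 2)^-1 : R.
have w0 x : 0 < w x.
  by rewrite invr_gt0 -addrA ltr_pwDl// addr_ge0// sqr_ge0.
have mw : measurable_fun setT w.
  rewrite (_ : w = fun x => (1 + complex.Re (g x) ^+ 2 + complex.Im (g x) ^+ 2) `^ (-1)).
    have [m1 m2] := mg; apply: (measurableT_comp (measurable_powR _)).
    apply: measurable_funD; last exact: measurable_funX.
    by apply: measurable_funD => //; exact: measurable_funX.
  apply/funext => x; rewrite powR_inv1//.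
  by rewrite -addrA addr_ge0// addr_ge0// sqr_ge0.
pose h x := g x * (w x)%:C.
have mh : cmeasurable h by apply: cmeasurableM => //; exact: cmeasurable_real.
have wE x : (w x)^-1 = 1 + normc (g x) ^+ 2.
  rewrite invrK -addrA; case: (g x) => a b /=.
  by rewrite sqr_sqrtr// addr_ge0// sqr_ge0.
have hb (t s : R) : `|t / (1 + t ^+ 2 + s ^+ 2)| <= 1.
  have p0 : 0 < 1 + t ^+ 2 + s ^+ 2 by have := sqr_ge0 t; have := sqr_ge0 s; lra.
  rewrite normrM normfV (gtr0_norm p0) ler_pdivrMr// mul1r.
  by rewrite ler_norml; apply/andP; split; nra.
exists h; split.
- have [mh1 mh2] := mh; split; apply: Lfun2_bounded => // x.
    rewrite (_ : complex.Re (h x) = complex.Re (g x) * w x) ?hb//.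
    by rewrite /h; case: (g x) => a b /=; rewrite mulr0 subr0.
  rewrite (_ : complex.Im (h x) = complex.Im (g x) * w x).
    by rewrite /w addrAC hb.
  by rewrite /h; case: (g x) => a b /=; rewrite mulr0 add0r.
- apply: contra_not gn0; apply: filterS => x /eqP.
  rewrite mulf_eq0 => /orP[/eqP//|/eqP w0'].
  by have := w0 x; rewrite -ltcR w0' ltxx.
- apply: filterS geig => x gx; rewrite /h gx mulrA; congr (_ * _%:C).
  by apply: invr_inj; rewrite !wE gx normcM normc_circle_exp mul1r.
Qed.

Variables (mu nu : probability X R) (r : nat).
Hypothesis r_gt0 : (0 < r)%N.
Hypothesis nu_inv : forall A, measurable A -> nu (iter r (@Defs.shift R) @^-1` A) = nu A.
Hypothesis muE : forall A, measurable A ->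
  mu A = ((r%:R^-1)%:E * \sum_(j < r) nu (iter j (@Defs.shift R) @^-1` A))%E.

Lemma measurable_preimage_iter j A : measurable A ->
  measurable (iter j (@Defs.shift R) @^-1` A).
Proof. by move=> mA; rewrite -[X in measurable X]setTI; exact: measurable_iter_shift. Qed.

(** The shift permutes the summands cyclically, up to the invariance of [nu]
under its [r]-th iterate. *)
Lemma average_shift_invariant A : measurable A -> mu (@Defs.shift R @^-1` A) = mu A.
Proof.
move=> mA; rewrite !muE//; last exact: (measurable_preimage_iter 1).
congr (_ * _)%E; move: r_gt0 nu_inv; case: r => // r' _ inv.
rewrite big_ord_recr big_ord_recl /= addeC; congr (_ + _)%E; first exact: inv.
Qed.

Lemma average_iter_invariant j A : measurable A -> mu (iter j (@Defs.shift R) @^-1` A) = mu A.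
Proof.
move=> mA; elim: j => // j IH; rewrite -IH -[RHS]average_shift_invariant.
  by congr (mu _); apply/funext => x; rewrite /preimage /= -iterSr.
exact: measurable_preimage_iter.
Qed.

Lemma average_dominates A : measurable A -> mu A = 0%E -> nu A = 0%E.
Proof.
move=> mA; rewrite muE// => /eqP; rewrite mule_eq0 eqe invr_eq0 pnatr_eq0.
rewrite -[_ == 0%N]negbK -lt0n r_gt0 /= => /eqP.
move: r_gt0; case: r => // r' _; rewrite big_ord_recl /=.
move/eqP; rewrite padde_eq0 ?measure_ge0 ?sume_ge0//; by case/andP => /eqP.
Qed.

(** The equation for [H] holds only almost everywhere for [nu]; multiplied by the
density of [nu] with respect to [mu], [H] satisfies it almost everywhere for
[mu], and the twisted sums [G l] of the product are eigenfunctions of the shift. *)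
Lemma spectrum_root (alpha : R) (H : X -> R[i]) : 0 <= alpha < 1 ->
  cmeasurable H -> ~ {ae nu, forall x, H x = 0} ->
  {ae nu, forall x, H (iter r (@Defs.shift R) x) = circle_exp alpha * H x} ->
  exists2 l : nat, (l < r)%N & spectrum mu ((alpha + l%:R) / r%:R).
Proof.
move=> /andP[a0 a1] mH Hn0 Heig.
have r0 : (0 : R) < r%:R by rewrite ltr0n.
have rn0 : (r%:R : R) != 0 by rewrite gt_eqF.
have [phi [phi0 mphi iphi phiE]] := density_exists average_dominates.
have mH' := cmeasurable_comp mH (@measurable_iter_shift R r).
have mHe : cmeasurable (fun x => circle_exp alpha * H x).
  by apply: cmeasurableM => //; exact: cmeasurable_cst.
pose G0 x := (phi x)%:C * H x.
have mG0 : cmeasurable G0 by apply: cmeasurableM => //; exact: cmeasurable_real.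
have G0eig : {ae mu, forall x, G0 (iter r (@Defs.shift R) x) = circle_exp alpha * G0 x}.
  have phi_inv : {ae mu, forall x, phi (iter r (@Defs.shift R) x) = phi x}.
    apply: (density_invariant phi0 mphi iphi phiE (@measurable_iter_shift R r)
      (@measurable_unshift R r) (@iter_shiftK R r) (@unshiftK R r)) => A mA.
      exact: average_iter_invariant.
    exact: nu_inv.
  pose E := [set x | H (iter r (@Defs.shift R) x) = circle_exp alpha * H x].
  have mE : measurable E by exact: measurable_ceq.
  have nuE : nu (~` E) = 0%E.
    have [N [mN N0 EN]] := Heig.
    by apply: (subset_measure0 _ _ EN N0) => //; exact: measurableC.
  have := (density_null phi0 mphi phiE (measurableC mE)).1 nuE.
  apply: filterS2 phi_inv => x px nEx; rewrite /G0 px.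
  have [Ex|nE] := pselect (E x); last by rewrite nEx// !mul0r mulr0.
  by rewrite Ex mulrCA.
pose b l : R := (alpha + l%:R) / r%:R.
pose G (l : nat) x := \sum_(j < r) circle_exp (- (j%:R * b l)) * G0 (iter j (@Defs.shift R) x).
have mG l : cmeasurable (G l).
  apply: (@cmeasurable_sum _ _ _ r (fun j x => circle_exp (- (j%:R * b l)) * G0 (iter j (@Defs.shift R) x))) => j.
  apply: cmeasurableM; first exact: cmeasurable_cst.
  by apply: cmeasurable_comp => //; exact: measurable_iter_shift.
have Geig l : {ae mu, forall x, G l (Defs.shift x) = circle_exp (b l) * G l x}.
  apply: filterS G0eig => x Gx; rewrite /G.
  under eq_bigr do rewrite -iterSr.
  apply: (@twisted_sum_shift R (fun j => G0 (iter j (@Defs.shift R) x)) (b l) r r_gt0).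
  have -> : r%:R * b l = alpha + l%:R by rewrite /b mulrC divfK.
  by rewrite circle_expD circle_exp_nat mulr1; exact: Gx.
have [[l ln]|nex] := pselect (exists l : 'I_r, ~ {ae mu, forall x, G l x = 0}).
  exists l => //; apply: (spectrum_intro (g := G l)) => //.
  rewrite divr_ge0 ?addr_ge0 ?ler0n//= ltr_pdivrMr// mul1r.
  have : (l.+1%:R : R) <= r%:R by rewrite ler_nat.
  by rewrite -natr1; lra.
exfalso; apply: Hn0.
have G_0 : {ae mu, forall x, forall l : 'I_r, G l x = 0}.
  apply: filter_forall => l; apply: contrapT => ln; apply: nex; by exists l.
have sumG x : \sum_(l < r) G l x = r%:R * G0 x.
  exact: (@sum_twisted_sums R (fun j => G0 (iter j (@Defs.shift R) x)) alpha r r_gt0).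
pose Z := [set x | H x = 0].
have mZ : measurable Z by apply: measurable_ceq => //; exact: cmeasurable_cst.
suff : nu (~` Z) = 0%E by move=> Z0; exists (~` Z); split => //; exact: measurableC.
apply: (density_null phi0 mphi phiE (measurableC mZ)).2.
apply: filterS G_0 => x Gx Zx; have := sumG x; rewrite big1 => [/esym/eqP|l _]; last exact: Gx.
rewrite mulf_eq0 pnatr_eq0 -[_ == 0%N]negbK -lt0n r_gt0 /= mulf_eq0 => /orP[/eqP[]//|/eqP].
by [].
Qed.

End spectral_core.

(** * Weighted means of bounded sequences *)

Section weighted_means.
Variable R : realType.
Implicit Types (w u v : nat -> R) (N : nat).

Definition wsum w N := \sum_(m < N) w m.
Definition wmean w u N := (\sum_(m < N) w m * u m) / wsum w N.

(** The common features of constant and harmonic weights: partial sums diverge,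
and the total variation is finite, so that a translation of the sequence does
not change the limit of the weighted means. *)
Definition slowly_decreasing w := [/\ forall m, 0 < w m, forall m, w m.+1 <= w m
  & wsum w @ \oo --> +oo].

Lemma wmeanB w u v N : wmean w (fun m => u m - v m) N = wmean w u N - wmean w v N.
Proof.
rewrite /wmean -mulrBl -sumrB; congr (_ / _).
by apply: eq_bigr => m _; rewrite mulrBr.
Qed.

Lemma wsum_gt0 w N : (forall m, 0 < w m) -> (0 < N)%N -> 0 < wsum w N.
Proof.
move=> w0; case: N => // N _; rewrite /wsum big_ord_recl ltr_wpDr//.
by apply: sumr_ge0 => i _; exact: ltW.
Qed.

Lemma wsum_ge0 w N : (forall m, 0 < w m) -> 0 <= wsum w N.
Proof. by move=> w0; apply: sumr_ge0 => i _; exact: ltW. Qed.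

Lemma mean_wmean (X : Type) w (y : nat -> X) N : (forall m, 0 < w m) -> (0 < N)%N ->
  mean (fun F => wmean w (fun m => F (y m)) N).
Proof.
move=> w0 N0; have W0 := wsum_gt0 w0 N0; split.
- move=> a F G; rewrite /wmean mulrA -mulrDl; congr (_ / _).
  rewrite mulr_sumr -big_split; apply: eq_bigr => m _ /=; ring.
- move=> F F0; apply: divr_ge0; last exact: ltW.
  by apply: sumr_ge0 => m _; rewrite mulr_ge0// ltW.
- rewrite /wmean; under eq_bigr do rewrite mulr1.
  by rewrite divff// gt_eqF.
Qed.

Lemma cvg_bounded_div w (s : nat -> R) C : slowly_decreasing w ->
  (forall N, `|s N| <= C) -> (fun N => s N / wsum w N) @ \oo --> 0.
Proof.
move=> [w0 _ Woo] sC; apply/cvgr0Pnorm_lt => e e0.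
have : \forall N \near \oo, C / e < wsum w N.
  by move/cvgryPgt: Woo; apply.
apply: filterS2 (nbhs_infty_ge 1) => N N1 WN.
have W0 := wsum_gt0 w0 N1.
rewrite normrM normfV (gtr0_norm W0) ltr_pdivrMr// (le_lt_trans (sC N))//.
by rewrite mulrC -ltr_pdivrMr.
Qed.

(** Toeplitz: the terms before a large index contribute a bounded amount. *)
Lemma wmean_cvg0 w v : slowly_decreasing w -> v @ \oo --> 0 ->
  wmean w v @ \oo --> 0.
Proof.
move=> sw v0; have [w0 _ _] := sw; apply/cvgr0Pnorm_le => e e0.
have e20 : 0 < e / 2 by rewrite divr_gt0.
have [M _ vM] : \forall n \near \oo, `|v n| <= e / 2 by move/cvgr0Pnorm_le: v0; apply.
pose B := \sum_(m < M) w m * `|v m|.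
have B0 : 0 <= B by apply: sumr_ge0 => m _; rewrite mulr_ge0// ltW.
have bound N : `|\sum_(m < N) w m * v m| <= B + e / 2 * wsum w N.
  elim: N => [|N IH].
    by rewrite big_ord0 normr0 /wsum big_ord0 mulr0 addr0.
  rewrite /wsum !big_ord_recr /= mulrDr addrA -/(wsum w N).
  have [MN|NM] := leqP M N.
    rewrite (le_trans (ler_normD _ _))// lerD//.
    by rewrite normrM (gtr0_norm (w0 N)) mulrC ler_wpM2r ?(ltW (w0 _))//; exact: vM.
  apply: (@le_trans _ _ B); last by rewrite -addrA lerDl addr_ge0// mulr_ge0 ?wsum_ge0 ?(ltW e20)// ltW.
  rewrite -(big_ord_recr N (fun m => w m * v m))/= (le_trans (ler_norm_sum _ _ _))//.
  rewrite /B -(subnKC NM) big_split_ord /= -[leLHS]addr0 lerD//.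
    by apply: ler_sum => i _; rewrite normrM (gtr0_norm (w0 _)).
  by apply: sumr_ge0 => i _; rewrite mulr_ge0// ltW.
have BB (N : nat) : `|B| <= B by rewrite ger0_norm.
have /cvgr0Pnorm_le/(_ _ e20) := cvg_bounded_div sw BB.
apply: filterS2 (nbhs_infty_ge 1) => N N1.
have W0 := wsum_gt0 w0 N1.
rewrite /wmean !normrM !normfV (gtr0_norm W0) ger0_norm// !ler_pdivrMr// => BN.
by apply: (le_trans (bound N)); rewrite [e in leRHS]splitr mulrDl lerD2r.
Qed.

(** Summation by parts: the numerator of the difference is bounded by [2 C w 0]. *)
Lemma wmean_shift w u C : slowly_decreasing w -> (forall n, `|u n| <= C) ->
  (fun N => wmean w (fun m => u m.+1) N - wmean w u N) @ \oo --> 0.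
Proof.
move=> sw uC; have [w0 wS _] := sw.
under eq_fun do rewrite -wmeanB.
apply: (@cvg_bounded_div w _ (C * (w 0%N *+ 2))) => // N.
have C0 : 0 <= C by exact: le_trans (uC 0%N).
(* Removing the boundary term makes the estimate inductive. *)
suff H : `|\sum_(m < N) w m * (u m.+1 - u m) - w N * u N| <= C * (w 0%N *+ 2 - w N).
  rewrite -(subrK (w N * u N) (\sum_(m < N) _)) (le_trans (ler_normD _ _))//.
  apply: (le_trans (lerD H (_ : _ <= C * w N))); last by rewrite -mulrDr subrK.
  by rewrite normrM (gtr0_norm (w0 N)) mulrC ler_wpM2r// ltW.
elim: N => [|N IH].
  rewrite big_ord0 sub0r normrN normrM (gtr0_norm (w0 0%N)) mulr2n addrK mulrC.
  by rewrite ler_wpM2r// ltW.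
rewrite big_ord_recr /=.
have -> : \sum_(m < N) w m * (u m.+1 - u m) + w N * (u N.+1 - u N) - w N.+1 * u N.+1 =
  (\sum_(m < N) w m * (u m.+1 - u m) - w N * u N) + (w N - w N.+1) * u N.+1 by ring.
apply: (le_trans (ler_normD _ _)).
have -> : C * (w 0%N *+ 2 - w N.+1) = C * (w 0%N *+ 2 - w N) + (w N - w N.+1) * C by ring.
by rewrite lerD// normrM ger0_norm ?subr_ge0// ler_wpM2l// subr_ge0.
Qed.

Lemma wmean_shiftn w u C k : slowly_decreasing w -> (forall n, `|u n| <= C) ->
  (fun N => wmean w (fun m => u (m + k)%N) N - wmean w u N) @ \oo --> 0.
Proof.
move=> sw uC; elim: k => [|k IH].
  under eq_fun do under eq_fun do rewrite addn0.
  by under eq_fun do rewrite subrr; exact: cvg_cst.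
have := wmean_shift sw (fun n => uC (n + k)%N).
move=> /cvgD/(_ IH); rewrite addr0; apply: cvg_trans; apply: near_eq_cvg.
apply: nearW => N /=; rewrite addrA subrK; congr (wmean _ _ _ - _).
by apply/funext => m; rewrite addSnnS.
Qed.

End weighted_means.

(** * Means over blocks of length r *)

Section block_means.
Variable R : realType.
Implicit Types (w u v : nat -> R) (N : nat).

Definition cesaro_weight (m : nat) : R := 1.
Definition log_weight (m : nat) : R := m.+1%:R^-1.

Lemma wsum_cesaro N : wsum cesaro_weight N = N%:R.
Proof. by rewrite /wsum sumr_const card_ord. Qed.

Lemma slowly_decreasing_cesaro : slowly_decreasing cesaro_weight.
Proof.
split => //; rewrite (_ : wsum _ = (fun N => N%:R)); last by apply/funext => N; exact: wsum_cesaro.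
exact: cvgr_idn.
Qed.

Lemma slowly_decreasing_log : slowly_decreasing log_weight.
Proof.
split => [m|m|]; first by rewrite invr_gt0.
  by rewrite lef_pV2 ?posrE// ler_nat.
rewrite (_ : wsum _ = series (@harmonic R)); last first.
  by apply/funext => N; rewrite /wsum /series /= big_mkord.
have nd : nondecreasing_seq (series (@harmonic R)).
  by apply/nondecreasing_seqP => n; rewrite seriesSr lerDl harmonic_ge0.
exact: nondecreasing_dvgn_lt nd (@dvg_harmonic R).
Qed.

Definition block_mean (r : nat) u (m : nat) : R :=
  r%:R^-1 * \sum_(j < r) u (r * m.+1 + j)%N.

Lemma sum_blocks (r N : nat) (a : nat -> R) :
  \sum_(m < N) \sum_(j < r) a (r * m + j)%N = \sum_(n < r * N) a n.
Proof.
elim: N => [|N IH]; first by rewrite muln0 !big_ord0.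
by rewrite big_ord_recr /= IH mulnS addnC big_split_ord.
Qed.

Lemma cesaro_block_mean r u N : (0 < r)%N ->
  wmean cesaro_weight (block_mean r u) N =
  wmean cesaro_weight (fun n => u (n + r)%N) (r * N)%N.
Proof.
move=> r0; rewrite /wmean !wsum_cesaro natrM invfM mulrA; congr (_ / _).
under [in RHS]eq_bigr do rewrite mul1r.
rewrite -(@sum_blocks r N (fun n => u (n + r)%N)) mulr_suml; apply: eq_bigr => m _.
rewrite mul1r /block_mean mulrC; congr (_ * _); apply: eq_bigr => j _; congr u; lia.
Qed.

(** The block mean puts on time [n + r] the weight [1 / (r (n %/ r).+1)], which
lies between [1 / (n + r).+1] and [1 / n.+1]; the total difference with the
logarithmic weight is bounded by telescoping.  The times between [N] and [r N]
have bounded total weight as well. *)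
Lemma log_block_mean r u C : (0 < r)%N -> (forall n, `|u n| <= C) ->
  (fun N => wmean log_weight (block_mean r u) N - wmean log_weight (fun n => u n.+1) N)
  @ \oo --> 0.
Proof.
move=> r0 uC; have C0 : 0 <= C by exact: le_trans (uC 0%N).
have rn0 : (r%:R : R) != 0 by rewrite pnatr_eq0 -lt0n.
have : (fun N => wmean log_weight (block_mean r u) N - wmean log_weight (fun n => u (n + r)%N) N)
    @ \oo --> 0.
  under eq_fun do rewrite -wmeanB.
  apply: (@cvg_bounded_div _ _ _ (C * r%:R + C * r%:R) slowly_decreasing_log) => N.
  pose c n : R := (r * (n %/ r).+1)%:R^-1.
  (* [c n] is the weight received by time [n + r]. *)
  have cw n : c n <= log_weight n.
    by rewrite lef_pV2 ?posrE ?ltr0n ?muln_gt0 ?r0// ler_nat mulnC ltn_ceil.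
  have wc n : log_weight (n + r) <= c n.
    rewrite lef_pV2 ?posrE ?ltr0n ?muln_gt0 ?r0// ler_nat mulnS addnC.
    by rewrite ltnW// ltnS leq_add2r mulnC leq_divM.
  have -> : \sum_(m < N) log_weight m * (block_mean r u m - u (m + r)%N) =
     \sum_(n < r * N) (c n - log_weight n) * u (n + r)%N +
     (\sum_(n < r * N) log_weight n * u (n + r)%N - \sum_(n < N) log_weight n * u (n + r)%N).
    under [X in X + _]eq_bigr do rewrite mulrBl.
    rewrite sumrB addrA subrK; under eq_bigr do rewrite mulrBr.
    rewrite sumrB; congr (_ - _).
    rewrite -(@sum_blocks r N (fun n => c n * u (n + r)%N)); apply: eq_bigr => m _.
    rewrite /block_mean mulrA mulr_sumr; apply: eq_bigr => j _.
    have -> : c (r * m + j)%N = log_weight m * r%:R^-1.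
      by rewrite /c (mulnC r m) divnMDl// divn_small// addn0 -invfM -natrM mulnC.
    congr (_ * u _); rewrite mulnS; lia.
  rewrite (le_trans (ler_normD _ _))// lerD//.
    apply: (le_trans (ler_norm_sum _ _ _)).
    apply: (@le_trans _ _ (\sum_(n < r * N) C * (log_weight n - log_weight (n + r)))).
      apply: ler_sum => n _; rewrite normrM mulrC ler_pM//.
      by rewrite distrC ger0_norm ?subr_ge0// lerD2l lerN2.
    rewrite -mulr_sumr ler_wpM2l// sumrB lerBlDr.
    apply: (@le_trans _ _ (\sum_(n < r + r * N) log_weight n)).
      rewrite addnC big_split_ord /= lerDl; apply: sumr_ge0 => i _.
      by rewrite invr_ge0.
    rewrite big_split_ord /= lerD//; last first.
      by apply: ler_sum => i _; rewrite addnC.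
    rewrite -[leRHS](wsum_cesaro r); apply: ler_sum => i _.
    by rewrite invf_le1 ?ler1n.
  have -> : (r * N = N + r.-1 * N)%N by rewrite -mulSn prednK.
  rewrite big_split_ord /= addrAC subrr add0r.
  apply: (le_trans (ler_norm_sum _ _ _)).
  apply: (@le_trans _ _ (\sum_(i < r.-1 * N) C * N.+1%:R^-1)).
    apply: ler_sum => i _; rewrite normrM mulrC ler_pM//.
    by rewrite ger0_norm ?invr_ge0// lef_pV2 ?posrE// ler_nat ltnS leq_addr.
  rewrite sumr_const card_ord -mulrnAr ler_wpM2l// -[_ *+ _]mulr_natl.
  rewrite ler_pdivrMr// -natrM ler_nat leq_mul ?leq_pred//.
move=> H; have := @wmean_shiftn R log_weight (fun n => u n.+1) C r.-1 slowly_decreasing_log (fun n => uC n.+1).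
move=> /(cvgD H); rewrite addr0; apply: cvg_trans; apply: near_eq_cvg.
apply: nearW => N /=; rewrite addrA; congr (_ - _).
rewrite -[RHS]addr0 -addrA; congr (_ + _); apply/eqP; rewrite addrC subr_eq0; apply/eqP.
congr (wmean _ _ _); apply/funext => n; congr u; lia.
Qed.

Lemma cesaro_wmean_truncate r v C (n : nat) : (0 < r)%N -> (r <= n)%N -> (forall n, `|v n| <= C) ->
  `|wmean cesaro_weight v (r * (n %/ r))%N - wmean cesaro_weight v n| <= (C *+ 2 * r%:R) / n%:R.
Proof.
move=> r0 rn vC; have C0 : 0 <= C by exact: le_trans (vC 0%N).
rewrite /wmean !wsum_cesaro; under eq_bigr do rewrite mul1r.
under [X in _ - X / _]eq_bigr do rewrite mul1r.
set q := (r * (n %/ r))%N; pose s := (n %% r)%N.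
have nE : n = (q + s)%N by rewrite /q mulnC; exact: divn_eq.
have sr : (s < r)%N by rewrite ltn_mod.
have q0 : (0 < q)%N by rewrite muln_gt0 r0 divn_gt0.
have n0 : (0 : R) < n%:R by rewrite ltr0n (leq_trans r0).
have q0' : (0 : R) < q%:R by rewrite ltr0n.
rewrite [X in _ - X / _](_ : _ = \sum_(i < q) v i + \sum_(i < s) v (q + i)%N); last first.
  by rewrite [in LHS]nE big_split_ord.
set A := \sum_(i < q) v i; set B := \sum_(i < s) _.
have AC : `|A| <= C * q%:R.
  rewrite (le_trans (ler_norm_sum _ _ _))// (le_trans (ler_sum _ (fun (i : 'I_q) _ => vC i)))//.
  by rewrite sumr_const card_ord mulr_natr.
have BC : `|B| <= C * s%:R.
  rewrite (le_trans (ler_norm_sum _ _ _))// (le_trans (ler_sum _ (fun (i : 'I_s) _ => vC (q + i)%N)))//.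
  by rewrite sumr_const card_ord mulr_natr.
have sr' : (s%:R : R) <= r%:R by rewrite ler_nat ltnW.
have nE' : n%:R = q%:R + s%:R :> R by rewrite -natrD -nE.
have -> : A / q%:R - (A + B) / n%:R = (A / q%:R * s%:R - B) / n%:R.
  have nn0 : q%:R + s%:R != 0 :> R by rewrite -nE' gt_eqF.
  by rewrite nE'; field; rewrite nn0 gt_eqF.
rewrite normrM normfV (gtr0_norm n0) ler_pM2r ?invr_gt0//.
apply: (le_trans (ler_normB _ _)).
have : `|A / q%:R * s%:R| <= C * s%:R.
  rewrite !normrM normfV (gtr0_norm q0') normr_nat ler_wpM2r//.
  by rewrite ler_pdivrMr.
move=> H; apply: (le_trans (lerD H BC)).
by rewrite -mulrDl -mulr2n ler_wpM2l// mulrn_wge0.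
Qed.

End block_means.

(** * Empirical measures as weighted means *)

Section Rintegral_finite_sums.
Variable R : realType.
Local Notation X := (shift_space R).
Implicit Types (F : X -> R).

(** Reduction to nonnegative functions, for which integrals with respect to sums
and multiples of measures are computed in the extended reals. *)
Lemma Rintegral_translate (m : {measure set X -> \bar R}) F C : (m setT < +oo)%E -> measurable_fun setT F ->
  (forall x, `|F x| <= C) ->
  \int[m]_x F x = \int[m]_x (F x + C) - \int[m]_x C.
Proof.
move=> mT mF FC.
rewrite -RintegralB//.
- by apply: eq_Rintegral => x _; rewrite addrK.
- apply: (@integrable_bounded _ _ _ (C + `|C|)) => //; first exact: measurable_funD.
  by move=> x; rewrite (le_trans (ler_normD _ _))// lerD.
- exact: (@integrable_bounded _ _ _ `|C|).
Qed.

Lemma bounded_integral_fin_num (m : {measure set X -> \bar R}) F C : (m setT < +oo)%E ->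
  measurable_fun setT F -> (forall x, `|F x| <= C) ->
  (\int[m]_x (F x)%:E)%E \is a fin_num.
Proof.
by move=> mT mF FC; apply: integrable_fin_num => //; exact: (@integrable_bounded _ _ _ C).
Qed.

Lemma ge0_Rintegral_mscale (c : {nonneg R}) (m : {measure set X -> \bar R}) F C :
  (m setT < +oo)%E -> measurable_fun setT F -> (forall x, `|F x| <= C) ->
  (forall x, 0 <= F x) -> \int[mscale c m]_x F x = c%:num * \int[m]_x F x.
Proof.
move=> mT mF FC F0; rewrite /Rintegral ge0_integral_mscale//.
- by rewrite fineM// (bounded_integral_fin_num mT mF FC).
- by apply/measurable_EFinP.
- by move=> x _; rewrite lee_fin.
Qed.

Lemma translate_bound F C : (forall x, `|F x| <= C) ->
  (forall x, `|F x + C| <= C + C) /\ (forall x, 0 <= F x + C).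
Proof.
move=> FC; have F0 x : 0 <= F x + C by have := FC x; rewrite ler_norml => /andP[]; lra.
split => // x; rewrite ger0_norm// lerD2r; exact: le_trans (ler_norm _) (FC x).
Qed.

Lemma Rintegral_mscale (c : {nonneg R}) (m : {measure set X -> \bar R}) F C :
  (m setT < +oo)%E -> measurable_fun setT F -> (forall x, `|F x| <= C) ->
  \int[mscale c m]_x F x = c%:num * \int[m]_x F x.
Proof.
move=> mT mF FC; have [FC2 FC0] := translate_bound FC.
have cT : (mscale c m setT < +oo)%E.
  by rewrite /mscale /= lte_mul_pinfty.
have C0 (x : X) : 0 <= C by exact: le_trans (FC x).
rewrite !(@Rintegral_translate _ F C)// mulrBr; congr (_ - _).
  by apply: (ge0_Rintegral_mscale _ mT _ FC2) => //; exact: measurable_funD.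
by apply: (@ge0_Rintegral_mscale _ _ _ C mT) => // x; rewrite ger0_norm// (C0 x).
Qed.

Lemma ge0_Rintegral_msum (m : nat -> {measure set X -> \bar R}) (N : nat) F C :
  (forall k, (m k setT < +oo)%E) -> measurable_fun setT F -> (forall x, `|F x| <= C) ->
  (forall x, 0 <= F x) -> \int[msum m N]_x F x = \sum_(k < N) \int[m k]_x F x.
Proof.
move=> mT mF FC F0; rewrite /Rintegral ge0_integral_measure_sum//.
- rewrite -sum_fine// => k _; exact: (bounded_integral_fin_num (mT k) mF FC).
- by move=> x _; rewrite lee_fin.
- by apply/measurable_EFinP.
Qed.

Lemma Rintegral_msum (m : nat -> {measure set X -> \bar R}) (N : nat) F C :
  (forall k, (m k setT < +oo)%E) -> measurable_fun setT F -> (forall x, `|F x| <= C) ->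
  \int[msum m N]_x F x = \sum_(k < N) \int[m k]_x F x.
Proof.
move=> mT mF FC; have [FC2 FC0] := translate_bound FC.
have C0 (x : X) : 0 <= C by exact: le_trans (FC x).
have sT : (msum m N setT < +oo)%E by rewrite /msum /= lte_sum_pinfty.
rewrite (Rintegral_translate sT mF FC).
under eq_bigr do rewrite (Rintegral_translate (mT _) mF FC).
rewrite sumrB; congr (_ - _).
  by apply: (ge0_Rintegral_msum _ _ _ FC2) => //; exact: measurable_funD.
by apply: (@ge0_Rintegral_msum _ _ _ C) => // x; rewrite ger0_norm// (C0 x).
Qed.

Lemma Rintegral_dirac (y : X) F : measurable_fun setT F -> \int[\d_y]_x F x = F y.
Proof.
move=> mF; rewrite /Rintegral integral_dirac//; last exact/measurable_EFinP.
by rewrite diracT mul1e.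
Qed.

Lemma dirac_lty (y : X) : (\d_y [set: X] < +oo :> \bar R)%E.
Proof. by rewrite diracT ltry. Qed.

Lemma mscale_dirac_lty (c : {nonneg R}) (y : X) :
  (mscale c \d_y [set: X] < +oo :> \bar R)%E.
Proof. by rewrite /mscale /= diracT mule1 ltry. Qed.

Lemma Rintegral_cesaro (x : X) N F : continuous F ->
  \int[cesaro_measure x N]_y F y =
  wmean (@cesaro_weight R) (fun m => F (iter m.+1 (@Defs.shift R) x)) N.
Proof.
move=> cF; have [C C0 FC] := continuous_bounded cF.
have mF := continuous_measurable_real cF.
rewrite (Rintegral_mscale _ _ mF FC)/=; last first.
  by rewrite /msum/= lte_sum_pinfty// => k _; exact: dirac_lty.
rewrite (Rintegral_msum _ _ mF FC)//; last by move=> k; exact: dirac_lty.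
rewrite /wmean wsum_cesaro mulrC; congr (_ / _); apply: eq_bigr => k _.
by rewrite Rintegral_dirac// mul1r.
Qed.

Lemma Rintegral_log (x : X) N F : continuous F ->
  \int[log_measure x N]_y F y =
  wmean (@log_weight R) (fun m => F (iter m.+1 (@Defs.shift R) x)) N.
Proof.
move=> cF; have [C C0 FC] := continuous_bounded cF.
have mF := continuous_measurable_real cF.
rewrite (Rintegral_mscale _ _ mF FC)/=; last first.
  by rewrite /msum/= lte_sum_pinfty// => k _; exact: mscale_dirac_lty.
rewrite (Rintegral_msum _ _ mF FC)//; last by move=> k; exact: mscale_dirac_lty.
rewrite /wmean mulrC; congr (_ / _); apply: eq_bigr => k _.
by rewrite (Rintegral_mscale _ _ mF FC) ?Rintegral_dirac//; exact: dirac_lty.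
Qed.

End Rintegral_finite_sums.

(** * Dilation of the coordinates *)

Section dilation.
Variable R : realType.
Local Notation X := (shift_space R).
Local Notation T := (@Defs.shift R).

(** By compactness, the values of [F] at [z = u m] and [v m] need only be
compared for [z] near a fixed [x] and [m] large; there both points are close to
[x], because [v m] has eventually the coordinates of [z]. *)
Lemma cvg_sub_eventually_eq (u v : nat -> X) (F : X -> R) :
  (forall k, \forall m \near \oo, u m k = v m k) -> continuous F ->
  (fun m => F (u m) - F (v m)) @ \oo --> 0.
Proof.
move=> uv cF; apply/cvgr0Pnorm_lt => e e0.
have e20 : 0 < e / 2 by rewrite divr_gt0.
have cX := (@compact_near_coveringP X setT).1 (@shift_space_compact R).
have /= := cX nat \oo (fun m z => u m = z -> `|F z - F (v m)| < e) _ _.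
suff H (x : X) : [set: X] x -> \forall z \near x & m \near \oo, u m = z -> `|F z - F (v m)| < e.
  by move=> /(_ _ H); apply: filterS => m /(_ (u m) I erefl).
move=> _.
(* The filter of pairs [(z, m)] with [z = u m], [z] near [x] and [m] large; along it [v m] tends to [x]. *)
pose G := within [set zm : X * nat | u zm.2 = zm.1] (filter_prod (nbhs x) \oo).
have FG : Filter G by apply: within_filter.
have vx : (fun zm : X * nat => v zm.2) @ G --> x.
  apply: (@cvg_prod_topology int (fun=> unit_disc R) _ G (fun zm : X * nat => v zm.2) x) => k.
  move=> B xB.
  have nB : nbhs x [set z : X | B (z k)] by exact: (@continuous_proj int (fun=> unit_disc R) k x B xB).
  exists ([set z : X | B (z k)], [set m | u m k = v m k]); first by split => //; exact: uv.
  by move=> [z m] /= [Bz uvm] uz; rewrite -uvm uz.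
have Fv : (fun zm : X * nat => F (v zm.2)) @ G --> F x.
  by apply: (cvg_comp _ _ vx); exact: cF.
have /cvgrPdist_lt/(_ _ e20) := Fv; have /cvgrPdist_lt/(_ _ e20) nF := cF x.
move=> [[A B] [/= nA nB] AB].
exists (A `&` [set z | `|F x - F z| < e / 2], B) => /=; first by split => //; exact: filterI.
move=> [z m] /= [[Az xz] Bm] uz.
have := AB (z, m) (conj Az Bm) uz => /= xv.
apply: le_lt_trans (ler_distD (F x) _ _) _; rewrite distrC [e]splitr.
exact: ltrD.
Qed.

(** With [c = (f r)^-1] this undoes, on the orbit of an extension of [f], the
multiplication of the times by [r]. *)
Definition dilate (c : R[i]) (r : nat) (x : X) : X :=
  fun k => clip (c * val (x (k * r%:Z))).

Lemma continuous_dilate c r : continuous (dilate c r).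
Proof.
move=> x.
apply: (@cvg_prod_topology int (fun=> unit_disc R) X (nbhs x) (dilate c r)) => k.
pose g (z : R[i]^o) : R[i]^o := c * z.
have cg : continuous g.
  by move=> z; apply: (@cvgMr R[i] R[i] (nbhs (z : R[i]^o)) (@nbhs_filter R[i]^o z) id c z); exact: cvg_id.
have cp : continuous (fun x : X => x (k * r%:Z)) := @continuous_proj int (fun=> unit_disc R) _.
have := continuous_comp (continuous_comp (continuous_comp (cp x) (@val_continuous R _)) (cg _)) (@continuous_clip R _).
exact.
Qed.

Lemma measurable_dilate c r : measurable_fun setT (dilate c r).
Proof. by apply: continuous_measurable_self; exact: continuous_dilate. Qed.

Lemma dilate_iter_shift c r (x : X) : dilate c r (iter r T x) = T (dilate c r x).
Proof.
apply/funext => k; rewrite /dilate /Defs.shift iter_shiftE.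
by rewrite mulrDl mul1r.
Qed.

(** For large [m] the coordinate involved is [f (r n)] with [n = k + m.+1]
positive, whatever the extension of [f] to the negative integers. *)
Lemma dilate_multiplicative (f : nat -> R[i]) (x : X) (r : nat) (k : int) :
  (forall n, (0 < n)%N -> `|f n| <= 1) -> (forall n, (0 < n)%N -> f n <> 0) ->
  completely_multiplicative f -> extends f x -> (0 < r)%N ->
  \forall m \near \oo, dilate (f r)^-1 r (iter (r * m.+1) T x) k = iter m.+1 T x k.
Proof.
move=> f1 f0 fM fx r0; near=> m.
have [n n0 nE] : exists2 n : nat, (0 < n)%N & k + m.+1%:Z = n%:Z.
  have km : (absz k <= m)%N by near: m; exact: nbhs_infty_ge.
  by exists (absz (k + m.+1%:Z)); lia.
apply: val_inj; rewrite /dilate !iter_shiftE /=.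
have -> : k * r%:Z + (r * m.+1)%N%:Z = (r * n)%N%:Z by rewrite !PoszM -nE; ring.
rewrite nE !fx ?muln_gt0 ?r0// fM// mulKf; last exact/eqP/f0.
by rewrite clip_id// f1.
Unshelve. all: by end_near. Qed.

End dilation.

(** * Transfer of spectra *)

Section spectra.
Variable R : realType.
Local Notation X := (shift_space R).
Local Notation T := (@Defs.shift R).

Lemma average_probability_exists (nu : probability X R) (r : nat) : (0 < r)%N ->
  exists mu : probability X R,
    (forall A, measurable A ->
       mu A = ((r%:R^-1)%:E * \sum_(j < r) nu (iter j T @^-1` A))%E) /\
    (forall F : X -> R, continuous F ->
       \int[mu]_x F x = r%:R^-1 * \sum_(j < r) \int[nu]_x F (iter j T x)).
Proof.
move=> r0; have rn0 : (r%:R : R) != 0 by rewrite pnatr_eq0 -lt0n.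
pose im j := image_probability nu (@measurable_iter_shift R j).
have i0 : 0 <= r%:R^-1 :> R by rewrite invr_ge0.
pose m : {measure set X -> \bar R} := mscale (NngNum i0) (msum (fun j => im j : {measure set X -> \bar R}) r).
have mE A : m A = ((r%:R^-1)%:E * \sum_(j < r) nu (iter j T @^-1` A))%E by [].
have [|mu muE] := @probability_of_measure _ X R m.
  rewrite mE (eq_bigr (fun=> 1%E)); last by move=> j _; rewrite preimage_setT; exact: probability_setT.
  by rewrite sumEFin sumr_const card_ord -EFinM mulVf.
exists mu; split=> [A _|F cF]; first by rewrite muE mE.
have [C C0 FC] := continuous_bounded cF.
have mF := continuous_measurable_real cF.
have imT j : (im j setT < +oo)%E by apply: le_lt_trans (probability_le1 _ _) (ltry _).
rewrite (_ : \int[mu]_x F x = \int[m]_x F x); last first.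
  by rewrite /Rintegral; congr fine; apply: eq_measure_integral => A _ _; exact: muE.
rewrite (Rintegral_mscale _ _ mF FC); last by rewrite /msum /= lte_sum_pinfty// => j _; exact: (imT j).
rewrite (Rintegral_msum _ imT mF FC) /=; congr (_ * _); apply: eq_bigr => j _.
by rewrite (Rintegral_image_probability _ _ mF FC).
Qed.

Lemma ae_image_probability (nu : probability X R) (S : X -> X) (mS : measurable_fun setT S)
    (P : X -> Prop) : measurable [set x | P x] ->
  {ae nu, forall x, P (S x)} -> {ae image_probability nu mS, forall x, P x}.
Proof.
move=> mP [N [mN N0 PN]]; exists (~` [set x | P x]); split => //; first exact: measurableC.
rewrite image_probabilityE; apply: (subset_measure0 _ mN _ N0) => //.
by rewrite -[X in measurable X]setTI; exact: (mS measurableT _ (measurableC mP)).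
Qed.

Lemma image_probability_ae (nu : probability X R) (S : X -> X) (mS : measurable_fun setT S)
    (P : X -> Prop) :
  {ae image_probability nu mS, forall x, P x} -> {ae nu, forall x, P (S x)}.
Proof.
move=> [N [mN N0 PN]]; exists (S @^-1` N); split => //.
  by rewrite -[X in measurable X]setTI; exact: (mS measurableT _ mN).
by move=> x /= nP; exact: PN.
Qed.

Lemma in_L2_cmeasurable (mu : probability X R) (g : X -> R[i]) : in_L2 mu g -> cmeasurable g.
Proof.
move=> [g1 g2]; split.
  by move: g1; rewrite inE => /andP[]; rewrite inE.
by move: g2; rewrite inE => /andP[]; rewrite inE.
Qed.

Lemma ae_dominates (mu nu : probability X R) (P : X -> Prop) :
  (forall A, measurable A -> mu A = 0%E -> nu A = 0%E) ->
  {ae mu, forall x, P x} -> {ae nu, forall x, P x}.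
Proof. by move=> munu [N [mN N0 PN]]; exists N; split => //; exact: munu. Qed.

Lemma spectrum_eq_measure (mu nu : probability X R) :
  (forall A, measurable A -> mu A = nu A) -> spectrum mu `<=` spectrum nu.
Proof.
move=> munu alpha [a01 [g [gL2 gn0 geig]]].
apply: (spectrum_intro (g := g)) => //.
- exact: in_L2_cmeasurable gL2.
- by move=> g0; apply/gn0/(ae_dominates _ g0) => A mA; rewrite munu.
- by apply: (ae_dominates _ geig) => A mA; rewrite munu.
Qed.

Lemma spectrum_dilation (mu nu : probability X R) (c : R[i]) (r : nat) alpha : (0 < r)%N ->
  (forall A, measurable A -> nu (iter r T @^-1` A) = nu A) ->
  (forall A, measurable A ->
       mu A = ((r%:R^-1)%:E * \sum_(j < r) nu (iter j T @^-1` A))%E) ->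
  spectrum (image_probability nu (@measurable_dilate R c r)) alpha ->
  exists2 alpha' : R, spectrum mu alpha' & exists k : int, r%:R * alpha' = alpha + k%:~R.
Proof.
move=> r0 nu_inv muE [a01 [g [gL2 gn0 geig]]].
have mg := in_L2_cmeasurable gL2.
have rn0 : (r%:R : R) != 0 by rewrite pnatr_eq0 -lt0n.
have [| | |l lr sl] := @spectrum_root R mu nu r r0 nu_inv muE alpha (fun x => g (dilate c r x)) a01.
- by apply: cmeasurable_comp => //; exact: measurable_dilate.
- move=> g0; apply: gn0; apply: ae_image_probability => //.
  by apply: measurable_ceq => //; exact: cmeasurable_cst.
- apply: filterS (image_probability_ae geig) => x.
  by rewrite dilate_iter_shift.
exists ((alpha + l%:R) / r%:R) => //; exists l%:Z.
by rewrite mulrC divfK.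
Qed.

(** The set of the points that are eventually in [A] is strictly invariant, and
equal to [A] almost everywhere. *)
Lemma ergodic_ae (mu : probability X R) (A : set X) : ergodic mu ->
  (forall B, measurable B -> mu (T @^-1` B) = mu B) -> measurable A ->
  {ae mu, forall x, A (T x) <-> A x} ->
  {ae mu, forall x, ~ A x} \/ {ae mu, forall x, A x}.
Proof.
move=> erg muT mA TA.
have mT := @measurable_iter_shift R 1.
pose B : set X := \bigcup_n \bigcap_(m in [set m | (n <= m)%N]) (iter m T @^-1` A).
have mB : measurable B.
  apply: bigcupT_measurable => n; apply: bigcap_measurable; first by exists n => /=.
  move=> k _; exact: measurable_preimage_iter.
have TB : T @^-1` B = B.
  apply/seteqP; split => x [n _ xn].
    exists n.+1 => // -[//|m] /= nm; rewrite /preimage /= -iterS iterSr; exact: xn.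
  by exists n => // m /= nm; rewrite /preimage /= -iterSr; apply: xn => /=; rewrite ltnW.
have AB : {ae mu, forall x, A x <-> B x}.
  have TAm m : {ae mu, forall x, A (iter m T x) <-> A x}.
    elim: m => [|m IH]; first exact: aeW.
    apply: filterS2 TA (ae_comp mT muT IH) => x h1 h2.
    by rewrite iterSr -h1; exact: h2.
  have /ae_foralln : forall m, {ae mu, forall x, A (iter m T x) <-> A x} by [].
  apply: filterS => x h; split=> [Ax|[n _ /(_ n (leqnn n)) /= /h]//].
  by exists 0%N => // m _; rewrite /preimage /=; apply/h.
have [B0|B1] := erg B mB TB.
  left; have : {ae mu, forall x, ~ B x} by exists B; split => // x /= /contrapT.
  by apply: filterS2 AB => x AB nB /AB.
right; have : {ae mu, forall x, B x}.
  exists (~` B); split => //; first exact: measurableC.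
  by rewrite probability_setC// B1 subee.
by apply: filterS2 AB => x AB /AB.
Qed.

End spectra.

(** * Limits along the multiples of r *)

Lemma cvgn_infty_ge (M : nat -> nat) : (forall k, (k <= M k)%N) -> M @ \oo --> \oo.
Proof.
move=> kM A [n _ nA]; exists n => // k /= nk; apply: nA => /=.
exact: leq_trans nk (kM k).
Qed.

Lemma homo_ltn_ge (N : nat -> nat) : {homo N : i j / (i < j)%N} -> forall k, (k <= N k)%N.
Proof.
move=> hN; elim=> // k IH; apply: leq_ltn_trans IH _; exact: hN.
Qed.

Lemma cvg_sub0 (R : realType) (a b : nat -> R) (l : R) :
  (fun k => a k - b k) @ \oo --> 0 -> b @ \oo --> l -> a @ \oo --> l.
Proof.
move=> ab bl; have -> : a = (fun k => (a k - b k) + b k) by apply/funext => k; rewrite subrK.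
by rewrite -[l]add0r; apply: cvgD.
Qed.

Lemma cvg_sub0r (R : realType) (a b : nat -> R) (l : R) :
  (fun k => a k - b k) @ \oo --> 0 -> a @ \oo --> l -> b @ \oo --> l.
Proof.
move=> ab al; have -> : b = (fun k => a k - (a k - b k)).
  by apply/funext => k; rewrite opprB addrC subrK.
by rewrite -[l]subr0; apply: cvgB.
Qed.

Section limit.
Variable R : realType.
Local Notation X := (shift_space R).
Local Notation T := (@Defs.shift R).

Definition orbit_mean (w : nat -> R) (x : X) (N : nat) (F : X -> R) : R :=
  wmean w (fun m => F (iter m.+1 T x)) N.

(** [nu] is a limit of the averages of the point masses at the times [r m];
[mu] averages its translates over a period, and [dilate] maps it to a limit of
the averages over all times. *)
Lemma dilation_limit (f : nat -> R[i]) (x : X) (r : nat) (w : nat -> R) (M : nat -> nat) :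
  (forall n, (0 < n)%N -> `|f n| <= 1) -> (forall n, (0 < n)%N -> f n <> 0) ->
  completely_multiplicative f -> extends f x -> (0 < r)%N ->
  slowly_decreasing w -> (forall k, (0 < M k)%N) -> M @ \oo --> \oo ->
  exists (phi : nat -> nat) (nu mu : probability X R), [/\ {homo phi : i j / (i < j)%N},
    forall A, measurable A -> nu (iter r T @^-1` A) = nu A,
    forall A, measurable A ->
       mu A = ((r%:R^-1)%:E * \sum_(j < r) nu (iter j T @^-1` A))%E,
    forall F : X -> R, continuous F ->
      (fun k => wmean w (block_mean r (fun n => F (iter n T x))) (M (phi k))) @ \oo -->
        \int[mu]_y F y
  & forall F : X -> R, continuous F ->
      (fun k => orbit_mean w x (M (phi k)) F) @ \oo -->
        \int[image_probability nu (@measurable_dilate R (f r)^-1 r)]_y F y].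
Proof.
move=> f1 f0 fM fx r0 sw M0 Moo; have [w0 _ _] := sw.
pose y m := iter (r * m.+1) T x.
have [phi [nu [phi_incr Lnu]]] := @weak_star_compact R
  (fun k F => wmean w (fun m => F (y m)) (M k)) (fun k => mean_wmean y w0 (M0 k)).
have [mu [muE muI]] := average_probability_exists nu r0.
have Mphi : (fun k => M (phi k)) @ \oo --> \oo.
  by apply: (cvg_comp phi M _ Moo); exact/cvgn_infty_ge/homo_ltn_ge.
have cT j (F : X -> R) : continuous F -> continuous (F \o iter j T).
  by move=> cF z; apply: continuous_comp; [exact: continuous_iter_shift|exact: cF].
exists phi, nu, mu; split => //.
- have imE F : continuous F ->
      \int[image_probability nu (@measurable_iter_shift R r)]_z F z = \int[nu]_z F z.
    move=> cF; have [C C0 FC] := continuous_bounded cF.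
    rewrite (Rintegral_image_probability _ _ (continuous_measurable_real cF) FC).
    have := @wmean_shift R w (fun m => F (y m)) C sw (fun n => FC _).
    move=> /(cvg_comp _ _ Mphi) /= /cvg_sub0 /(_ (Lnu _ cF)) l1.
    have l2 := Lnu _ (cT r F cF).
    have E : (fun k => wmean w (fun m => (F \o iter r T) (y m)) (M (phi k))) =
             (fun k => wmean w (fun m => F (y m.+1)) (M (phi k))).
      apply/funext => k; congr (wmean _ _ _); apply/funext => m /=.
      by rewrite -iterD /y; congr (F (iter _ _ _)); lia.
    rewrite E in l2; exact: (cvg_unique _ l2 l1).
  move=> A mA; rewrite -(measure_ext _ _ imE mA)//;
    by apply: le_lt_trans (probability_le1 _ _) (ltry _).
- move=> F cF; rewrite muI//.
  have -> : (fun k => wmean w (block_mean r (fun n => F (iter n T x))) (M (phi k))) =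
     (fun k => r%:R^-1 * \sum_(j < r) wmean w (fun m => F (iter j T (y m))) (M (phi k))).
    apply/funext => k; rewrite /wmean -mulr_suml mulrA exchange_big /= mulr_sumr; congr (_ / _).
    apply: eq_bigr => m _; rewrite -mulr_sumr mulrCA; congr (_ * (_ * _)).
    by apply: eq_bigr => j _; rewrite -iterD addnC.
  apply: cvgMr; apply: cvg_big => [|j _]; first exact: add_continuous.
  exact: (Lnu _ (cT j F cF)).
move=> F cF; have [C C0 FC] := continuous_bounded cF.
rewrite (Rintegral_image_probability _ _ (continuous_measurable_real cF) FC).
have cd : continuous (fun z => F (dilate (f r)^-1 r z)).
  by move=> z; apply: (continuous_comp (@continuous_dilate R (f r)^-1 r z)); exact: cF.
have := cvg_sub_eventually_eq (fun k => dilate_multiplicative k f1 f0 fM fx r0) cF.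
move=> /(wmean_cvg0 sw) /(cvg_comp _ _ Mphi) /=.
move=> H; apply: (cvg_sub0r _ (Lnu _ cd)).
by under eq_fun do rewrite -wmeanB; exact: H.
Qed.

End limit.

(** * Divisibility *)

Section divisibility.
Variable R : realType.
Local Notation X := (shift_space R).
Local Notation T := (@Defs.shift R).

Lemma probability_ext (mu nu : probability X R) :
  (forall F : X -> R, continuous F -> \int[mu]_x F x = \int[nu]_x F x) ->
  forall A, measurable A -> mu A = nu A.
Proof.
by apply: measure_ext; apply: le_lt_trans (probability_le1 _ _) (ltry _).
Qed.

Lemma cvg_log_measure (x : X) (N : nat -> nat) (mu : probability X R) (F : X -> R) :
  weak_star_cvg (fun k => log_measure x (N k)) mu -> continuous F ->
  (fun k => orbit_mean (@log_weight R) x (N k) F) @ \oo --> \int[mu]_y F y.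
Proof.
move=> /[swap] cF /(_ F cF); under eq_fun do rewrite Rintegral_log//; exact.
Qed.

Lemma cvg_cesaro_measure (x : X) (N : nat -> nat) (mu : probability X R) (F : X -> R) :
  weak_star_cvg (fun k => cesaro_measure x (N k)) mu -> continuous F ->
  (fun k => orbit_mean (@cesaro_weight R) x (N k) F) @ \oo --> \int[mu]_y F y.
Proof.
move=> /[swap] cF /(_ F cF); under eq_fun do rewrite Rintegral_cesaro//; exact.
Qed.

Section multiplicative.
Variable f : nat -> R[i].
Hypothesis f_disc : forall n, (0 < n)%N -> `|f n| <= 1.
Hypothesis f_neq0 : forall n, (0 < n)%N -> f n <> 0.
Hypothesis f_mul : completely_multiplicative f.

(** Here both limits provided by [dilation_limit] are the given measure. *)
Lemma log_spectrum_divisible (mu : probability X R) :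
  log_furstenberg_system f mu -> divisible (spectrum mu).
Proof.
move=> [x [N [fx N0 Nincr muN]]]; split => [a [] //|alpha r sa r0].
have Noo := cvgn_infty_ge (homo_ltn_ge Nincr).
have [phi [nu [mu' [phi_incr nu_inv muE mulim nulim]]]] :=
  dilation_limit f_disc f_neq0 f_mul fx r0 (@slowly_decreasing_log R) N0 Noo.
have phioo := cvgn_infty_ge (homo_ltn_ge phi_incr).
have muphi F (cF : continuous F) := cvg_comp _ _ phioo (cvg_log_measure muN cF).
have mu'E : forall A, measurable A -> mu' A = mu A.
  apply: probability_ext => F cF; have [C C0 FC] := continuous_bounded cF.
  have := log_block_mean r0 (fun n => FC (iter n T x)).
  move=> /(cvg_comp _ _ (cvg_comp _ _ phioo Noo)) /= H.
  exact: (cvg_unique _ (cvg_sub0r H (mulim F cF)) (muphi F cF)).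
have imE : forall A, measurable A -> mu A = image_probability nu (@measurable_dilate R (f r)^-1 r) A.
  apply: probability_ext => F cF; exact: (cvg_unique _ (muphi F cF) (nulim F cF)).
have [a' sa' ka'] := spectrum_dilation r0 nu_inv muE (spectrum_eq_measure imE sa).
by exists a' => //; exact: (spectrum_eq_measure mu'E sa').
Qed.

Lemma cesaro_block_cvg (x : X) (r : nat) (M : nat -> nat) (F : X -> R) (l : R) :
  (0 < r)%N -> M @ \oo --> \oo -> continuous F ->
  (fun k => wmean (@cesaro_weight R) (block_mean r (fun n => F (iter n T x))) (M k)) @ \oo --> l ->
  (fun k => orbit_mean (@cesaro_weight R) x (r * M k) F) @ \oo --> l.
Proof.
move=> r0 Moo cF; have [C C0 FC] := continuous_bounded cF.
have rMoo : (fun k => r * M k)%N @ \oo --> \oo.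
  by apply: (cvg_comp M (fun n => r * n)%N Moo); apply: cvgn_infty_ge => k; rewrite leq_pmull.
have := @wmean_shiftn R (@cesaro_weight R) (fun m => F (iter m.+1 T x)) C r.-1
  (@slowly_decreasing_cesaro R) (fun n => FC _).
move=> /(cvg_comp _ _ rMoo) /= H; move=> lim; apply: (cvg_sub0r H).
have E : (fun k => wmean (@cesaro_weight R) (block_mean r (fun n => F (iter n T x))) (M k)) =
    (fun k => wmean (@cesaro_weight R) (fun m => F (iter (m + r.-1).+1 T x)) (r * M k)%N).
  apply/funext => k; rewrite cesaro_block_mean//; congr (wmean _ _ _).
  by apply/funext => m; congr (F (iter _ _ _)); lia.
by rewrite E in lim.
Qed.

(** The limit of the block means is a Furstenberg system along [r N_k]. *)
Lemma cesaro_union_divisible :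
  divisible (\bigcup_(mu in [set mu : probability X R | cesaro_furstenberg_system f mu])
    spectrum mu).
Proof.
split=> [a [mu _ []]//|alpha r [mu [x [N [fx N0 Nincr muN]]] sa] r0].
have Noo := cvgn_infty_ge (homo_ltn_ge Nincr).
have [phi [nu [mu' [phi_incr nu_inv muE mulim nulim]]]] :=
  dilation_limit f_disc f_neq0 f_mul fx r0 (@slowly_decreasing_cesaro R) N0 Noo.
have phioo := cvgn_infty_ge (homo_ltn_ge phi_incr).
have muphi F (cF : continuous F) := cvg_comp _ _ phioo (cvg_cesaro_measure muN cF).
have imE : forall A, measurable A -> mu A = image_probability nu (@measurable_dilate R (f r)^-1 r) A.
  apply: probability_ext => F cF; exact: (cvg_unique _ (muphi F cF) (nulim F cF)).
have [a' sa' ka'] := spectrum_dilation r0 nu_inv muE (spectrum_eq_measure imE sa).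
exists a' => //; exists mu' => //.
exists x, (fun k => r * N (phi k))%N; split => //.
- by move=> k; rewrite muln_gt0 r0 N0.
- by move=> i j ij; rewrite ltn_pmul2l//; apply/Nincr/phi_incr.
- move=> F cF; under eq_fun do rewrite Rintegral_cesaro//.
  exact: (cesaro_block_cvg r0 (cvg_comp _ _ phioo Noo) cF (mulim F cF)).
Qed.

(** Positivity: the average over [m = n %/ r] is at most [n / m <= 2 r] times the
average over [n], for nonnegative functions. *)
Lemma mean_difference (x : X) (r n m : nat) : (0 < r)%N -> (r <= n)%N -> m = (n %/ r)%N ->
  mean (fun F : X -> R => (2 * r%:R - 1)^-1 *
    (2 * r%:R * orbit_mean (@cesaro_weight R) x n F - orbit_mean (@cesaro_weight R) x m F)).
Proof.
move=> r0 rn mE.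
have r1 : (1 : R) <= r%:R by rewrite ler1n.
have p0 : (0 : R) < 2 * r%:R - 1 by lra.
have n0 : (0 < n)%N by exact: leq_trans rn.
have m0 : (0 < m)%N by rewrite mE divn_gt0.
have mn : (m <= n)%N by rewrite mE leq_div.
have w0 (k : nat) : 0 < cesaro_weight R k by exact: ltr01.
have [linn posn n1] := mean_wmean (fun m => iter m.+1 T x) w0 n0.
have [linm posm m1] := mean_wmean (fun m => iter m.+1 T x) w0 m0.
rewrite /orbit_mean; split.
- move=> a F G; rewrite linn linm; ring.
- move=> F F0; rewrite mulr_ge0 ?invr_ge0 ?(ltW p0)// subr_ge0.
  rewrite /wmean !wsum_cesaro.
  under eq_bigr do rewrite mul1r; under [X in _ <= _ * (X / _)]eq_bigr do rewrite mul1r.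
  have Smn : \sum_(i < m) F (iter i.+1 T x) <= \sum_(i < n) F (iter i.+1 T x).
    rewrite -(subnKC mn) big_split_ord /= lerDl; apply: sumr_ge0 => i _; exact: F0.
  have S0 : 0 <= \sum_(i < m) F (iter i.+1 T x) by apply: sumr_ge0 => i _; exact: F0.
  have mR : (0 : R) < m%:R by rewrite ltr0n.
  have nR : (0 : R) < n%:R by rewrite ltr0n.
  have nm : n%:R <= 2 * r%:R * m%:R :> R.
    rewrite -!natrM ler_nat mE; have := divn_eq n r; have := ltn_pmod n r0; nia.
  rewrite ler_pdivrMr// mulrA mulrAC ler_pdivlMr//.
  nra.
- rewrite n1 m1 mulr1 mulVf// gt_eqF//.
Qed.

(** A limit of the means of [mean_difference] exhibits [2 r mu] as the sum of
[mu'] and a measure. *)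
Lemma cesaro_dilated_dominated (x : X) (r : nat) (N : nat -> nat) (mu mu' : probability X R) :
  (0 < r)%N -> (forall k, (r <= N k)%N) ->
  (forall F : X -> R, continuous F ->
    (fun k => orbit_mean (@cesaro_weight R) x (N k) F) @ \oo --> \int[mu]_y F y) ->
  (forall F : X -> R, continuous F ->
    (fun k => orbit_mean (@cesaro_weight R) x (N k %/ r) F) @ \oo --> \int[mu']_y F y) ->
  forall A, measurable A -> mu A = 0%E -> mu' A = 0%E.
Proof.
move=> r0 rN muN mu'N.
have r1 : (1 : R) <= r%:R by rewrite ler1n.
have p0 : (0 : R) < 2 * r%:R - 1 by lra.
have [psi [rho [psi_incr rhoN]]] := weak_star_compact
  (fun k => @mean_difference x r (N k) (N k %/ r) r0 (rN k) erefl).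
have psioo := cvgn_infty_ge (homo_ltn_ge psi_incr).
pose b : R := 2 * r%:R - 1.
have b0 : 0 <= b by exact: ltW.
have c0 : 0 <= 2 * r%:R :> R by rewrite mulr_ge0.
pose m1 : {measure set X -> \bar R} := mscale (NngNum c0) mu.
pose rho' : {measure set X -> \bar R} := mscale (NngNum b0) rho.
pose s (k : nat) : {measure set X -> \bar R} := 
  if k == 0%N then (mu' : {measure set X -> \bar R}) else rho'.
pose m2 : {measure set X -> \bar R} := msum s 2.
have pT (P : probability X R) : (P setT < +oo)%E.
  exact: le_lt_trans (probability_le1 P measurableT) (ltry _).
have rho'T : (rho' setT < +oo)%E by rewrite /rho' /= /mscale /= lte_mul_pinfty.
have sT k : (s k setT < +oo)%E by rewrite /s; case: ifP => _; [exact: pT|exact: rho'T].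
have m12 : forall A, measurable A -> m1 A = m2 A.
  apply: measure_ext; first by rewrite /m1 /= /mscale /= lte_mul_pinfty.
    by rewrite /m2 /= /msum lte_sum_pinfty.
  move=> F cF; have [C C0 FC] := continuous_bounded cF.
  have mF := continuous_measurable_real cF.
  rewrite (Rintegral_mscale _ (pT mu) mF FC) /= (Rintegral_msum _ sT mF FC).
  rewrite !big_ord_recl big_ord0 addr0 /s /= (Rintegral_mscale _ (pT rho) mF FC) /=.
  have lN := cvg_comp _ _ psioo (muN F cF); have lM := cvg_comp _ _ psioo (mu'N F cF).
  have l : (fun k => b^-1 * (2 * r%:R * orbit_mean (@cesaro_weight R) x (N (psi k)) F -
      orbit_mean (@cesaro_weight R) x (N (psi k) %/ r) F)) @ \oo -->
      b^-1 * (2 * r%:R * \int[mu]_y F y - \int[mu']_y F y).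
    by apply: cvgMr; apply: cvgB; [apply: cvgMr; exact: lN|exact: lM].
  have -> : \int[rho]_y F y = b^-1 * (2 * r%:R * \int[mu]_y F y - \int[mu']_y F y).
    exact: (cvg_unique _ (rhoN F cF) l).
  by rewrite mulrA divff ?gt_eqF// mul1r addrC subrK.
move=> A mA muA; have := m12 A mA.
rewrite /m1 /m2 /= /mscale /msum /= muA mule0 !big_ord_recl big_ord0 adde0 /s /=.
move/esym/eqP; rewrite padde_eq0// ?measure_ge0//.
by case/andP => /eqP.
Qed.

(** The averages over [N_k %/ r] give a measure [im] whose null sets include
those of [mu].  The zero set of the eigenfunction
is invariant for [mu], hence null for [mu] by ergodicity, hence for [im]. *)
Lemma cesaro_ergodic_divisible (mu : probability X R) :
  cesaro_furstenberg_system f mu -> ergodic mu -> divisible (spectrum mu).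
Proof.
move=> [x [N [fx N0 Nincr muN]]] erg; split => [a [] //|alpha r sa r0].
have Nge := homo_ltn_ge Nincr.
(* Skipping [r] terms ensures that [N' k %/ r] is positive. *)
pose N' k := N (k + r)%N.
have N'ge k : (k + r <= N' k)%N by exact: Nge.
have rN' k : (r <= N' k)%N by apply: leq_trans (N'ge k); rewrite leq_addl.
pose M k := (N' k %/ r)%N.
have M0 k : (0 < M k)%N by rewrite divn_gt0.
have kroo : (fun k => (k + r)%N) @ \oo --> \oo by apply: cvgn_infty_ge => k; rewrite leq_addr.
have N'oo : N' @ \oo --> \oo by apply: cvgn_infty_ge => k; apply: leq_trans (N'ge k); rewrite leq_addr.
have Moo : M @ \oo --> \oo.
  move=> A [n _ nA]; exists (n * r)%N => // k /= nk; apply: nA => /=.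
  by rewrite /M leq_divRL// (leq_trans nk)// (leq_trans _ (N'ge k))// leq_addr.
have [phi [nu [mu' [phi_incr nu_inv muE mulim nulim]]]] :=
  dilation_limit f_disc f_neq0 f_mul fx r0 (@slowly_decreasing_cesaro R) M0 Moo.
have phioo := cvgn_infty_ge (homo_ltn_ge phi_incr).
have muphi F (cF : continuous F) :=
  cvg_comp _ _ phioo (cvg_comp _ _ kroo (cvg_cesaro_measure muN cF)).
have mu'E : forall A, measurable A -> mu' A = mu A.
  apply: probability_ext => F cF; have [C C0 FC] := continuous_bounded cF.
  have H : (fun k => orbit_mean (@cesaro_weight R) x (r * M (phi k)) F -
                     orbit_mean (@cesaro_weight R) x (N' (phi k)) F) @ \oo --> 0.
    have := @cvg_bounded_div R _ (fun=> C *+ 2 * r%:R) _ (@slowly_decreasing_cesaro R) (fun=> lexx _).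
    move=> /(cvg_comp _ _ (cvg_comp _ _ phioo N'oo)) /cvgr0Pnorm_le D.
    apply/cvgr0Pnorm_le => e /D; apply: filterS => k /= Dk; apply: le_trans Dk.
    rewrite wsum_cesaro; apply: le_trans (ler_norm _).
    exact: (cesaro_wmean_truncate r0 (rN' (phi k)) (fun n => FC (iter n.+1 T x))).
  have := cesaro_block_cvg r0 (cvg_comp _ _ phioo Moo) cF (mulim F cF).
  by move=> /(cvg_sub0r H) H'; exact: (cvg_unique _ H' (muphi F cF)).
pose im := image_probability nu (@measurable_dilate R (f r)^-1 r).
have im_dom : forall A, measurable A -> mu A = 0%E -> im A = 0%E.
  exact: (cesaro_dilated_dominated r0 (fun k => rN' (phi k)) muphi nulim).
have mu_inv A : measurable A -> mu (T @^-1` A) = mu A.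
  move=> mA; rewrite -!mu'E//; last exact: (@measurable_preimage_iter R 1).
  exact: (average_shift_invariant r0 nu_inv muE).
have sim : spectrum im alpha.
  have [a01 [g [gL2 gn0 geig]]] := sa.
  have mg := in_L2_cmeasurable gL2.
  have mZ : measurable [set x | g x = 0] by apply: measurable_ceq => //; exact: cmeasurable_cst.
  apply: (spectrum_intro (g := g)) => //; last exact: ae_dominates im_dom geig.
  move=> g0; have [|/(ae_dominates im_dom) gn0'|//] := ergodic_ae erg mu_inv mZ.
    apply: filterS geig => z gz; rewrite /= gz; split => [/eqP|->]; last by rewrite mulr0.
    by rewrite mulf_eq0 (negbTE (circle_exp_neq0 _)) => /eqP.
  have [B [mB B0 BF]] : {ae im, forall z : X, False}.
    by apply: filterS2 g0 gn0' => z.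
  have := probability_setT im; rewrite (_ : [set: X] = B) ?B0.
    by move=> /eqP; rewrite eq_sym onee_eq0.
  by apply/seteqP; split => // z _; exact: BF.
have [a' sa' ka'] := spectrum_dilation r0 nu_inv muE sim.
by exists a' => //; exact: (spectrum_eq_measure mu'E sa').
Qed.

End multiplicative.
End divisibility.

Theorem corollary2p2 (R : realType) (f : nat -> R[i])
    (f_disc : forall n : nat, (0 < n)%N -> `|f n| <= 1)
    (f_neq0 : forall n : nat, (0 < n)%N -> f n <> 0)
    (f_mul : completely_multiplicative f) :
  (forall mu : probability (shift_space R) R,
     log_furstenberg_system f mu -> divisible (spectrum mu)) /\
  divisible (\bigcup_(mu in [set mu : probability (shift_space R) R |
     cesaro_furstenberg_system f mu]) spectrum mu) /\
  (forall mu : probability (shift_space R) R,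
     cesaro_furstenberg_system f mu -> ergodic mu -> divisible (spectrum mu)).
Proof.
split; first exact: (log_spectrum_divisible f_disc f_neq0 f_mul).
split; first exact: (cesaro_union_divisible f_disc f_neq0 f_mul).
exact: (cesaro_ergodic_divisible f_disc f_neq0 f_mul).
Qed.
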